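(* Let $\lambda\ge 0$ and let $Z$ be the complex-valued Ornstein-Uhlenbeck process with parameter $\lambda$ started from $z_0=1+i0$, with radial process $R^Z_t=|Z_t|$. Then the family of processes $$\left(t^{-1/2}\,\log R^{Z}_{st},\ s\ge 0\right)$$ converges in distribution, as $t\to 0$, to a one-dimensional Brownian motion $(\beta_s,\ s\ge 0)$ started from $0$.
   Context: The complex-valued Ornstein-Uhlenbeck (OU) process $Z$ with parameter $\lambda\ge 0$ started from $z_0$ is the solution of $Z_t=z_0+W_t-\lambda\int_0^t Z_s\,ds$, where $(W_t,t\ge 0)$ is a planar (complex-valued) Brownian motion with $W_0=0$. Throughout, $z_0=1+i0$. The process $Z$ a.s. never visits $0$. Convergence in distribution of processes is weak convergence in the sense of Skorokhod. *)

(* Defs.v *)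
From HB Require Import structures.
From mathcomp Require Import all_boot all_order all_algebra.
From mathcomp Require Import complex.
From mathcomp Require Import all_classical all_reals all_analysis.

Set Implicit Arguments.
Unset Strict Implicit.
Unset Printing Implicit Defensive.

Import Order.TTheory GRing.Theory Num.Theory.
Import numFieldNormedType.Exports.

Local Open Scope classical_set_scope.
Local Open Scope ring_scope.
Local Open Scope complex_scope.

(* A real (resp. complex) process is a function X : R -> T -> R (resp. R[i]),
   of which only the values X t w at times 0 <= t are ever used. *)

Section Independence.
Context {R : realType} {d : measure_display} {T : measurableType d}.
Variable P : probability T R.
Implicit Types X Y : R -> T -> R.

Definition process_events X : set (set T) :=
  <<s [set A | exists t : R, 0 <= t /\
                 exists2 B : set R, measurable B & A = X t @^-1` B] >>.

Definition independent_processes X Y : Prop :=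
  forall A B, process_events X A -> process_events Y B ->
    P (A `&` B) = (P A * P B)%E.

(* Taking some of the B i equal to setT gives the product rule for every
   subfamily. *)
Definition mutually_independent (n : nat) (D : 'I_n -> T -> R) : Prop :=
  forall B : 'I_n -> set R, (forall i, measurable (B i)) ->
    P (\bigcap_(i in [set: 'I_n]) (D i @^-1` B i)) =
    (\prod_(i < n) P (D i @^-1` B i))%E.

End Independence.

Section Brownian.
Context {R : realType} {d : measure_display} {T : measurableType d}.
Variable P : probability T R.

Definition continuous_path (x : R -> R) : Prop :=
  {within `[0, +oo[, continuous x}.

(* The second parameter of normal_prob is the standard deviation. *)
Definition brownian (B : R -> T -> R) : Prop :=
  [/\ forall t : R, 0 <= t -> measurable_fun [set: T] (B t),
      {ae P, forall w, B 0 w = 0},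
      forall (n : nat) (t : nat -> R), 0 <= t 0%N ->
        (forall i, t i <= t i.+1) ->
        mutually_independent P (fun (i : 'I_n) w => B (t i.+1) w - B (t i) w),
      forall s t : R, 0 <= s -> s < t -> forall A : set R, measurable A ->
        P ((fun w => B t w - B s w) @^-1` A) =
        normal_prob 0 (Num.sqrt (t - s)) A &
      {ae P, forall w, continuous_path (B ^~ w)} ].

Definition planar_brownian (W : R -> T -> R[i]) : Prop :=
  let X t w := complex.Re (W t w) in
  let Y t w := complex.Im (W t w) in
  [/\ brownian X, brownian Y & independent_processes P X Y].

Definition complex_integral (t : R) (f : R -> R[i]) : R[i] :=
  (\int[lebesgue_measure]_(s in `[0, t]) complex.Re (f s)) +i*
  (\int[lebesgue_measure]_(s in `[0, t]) complex.Im (f s)).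

Definition ornstein_uhlenbeck (W : R -> T -> R[i]) (lambda : R) (z0 : R[i])
    (Z : R -> T -> R[i]) : Prop :=
  [/\ forall t : R, 0 <= t ->
        measurable_fun [set: T] (fun w => complex.Re (Z t w)) /\
        measurable_fun [set: T] (fun w => complex.Im (Z t w)),
      {ae P, forall w, continuous_path (fun t => complex.Re (Z t w)) /\
                       continuous_path (fun t => complex.Im (Z t w))} &
      {ae P, forall w, forall t : R, 0 <= t ->
        Z t w = z0 + W t w - lambda%:C * complex_integral t (Z ^~ w)} ].

Definition radial (Z : R -> T -> R[i]) (t : R) (w : T) : R :=
  complex.Re `|Z t w|.

End Brownian.

Section Skorokhod.
Context {R : realType}.
Implicit Types x l : R -> R.

Definition cadlag x : Prop :=
  (forall s : R, 0 <= s -> x r @[r --> s^'+] --> x s) /\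
  (forall s : R, 0 < s -> cvg (x r @[r --> s^'-])).

Definition time_change l : Prop :=
  [/\ l 0 = 0,
      forall r s : R, 0 <= r -> r < s -> l r < l s,
      continuous_path l &
      l s @[s --> +oo] --> +oo].

(* Convergence of sequences in the Skorokhod J1 topology on D([0, +oo[, R), as
   in Jacod and Shiryaev, Limit Theorems for Stochastic Processes, VI.1.14.
   That topology is metrizable, so its convergent sequences determine it, and
   continuity of a functional is sequential continuity. *)
Definition skorokhod_cvg (x_ : nat -> R -> R) x : Prop :=
  exists l_ : nat -> R -> R,
    [/\ forall n, time_change (l_ n),
        forall e : R, 0 < e -> \forall n \near \oo,
          forall s : R, 0 <= s -> `|l_ n s - s| < e &
        forall N e : R, 0 < e -> \forall n \near \oo,
          forall s : R, 0 <= s <= N -> `|x_ n (l_ n s) - x s| < e].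

Definition skorokhod_continuous (F : (R -> R) -> R) : Prop :=
  forall (x_ : nat -> R -> R) x, (forall n, cadlag (x_ n)) -> cadlag x ->
    skorokhod_cvg x_ x -> F (x_ n) @[n --> \oo] --> F x.

Definition bounded_functional (F : (R -> R) -> R) : Prop :=
  exists M, forall x, `|F x| <= M.

Definition cadlag_process {d} {T : measurableType d} (P : probability T R)
    (X : R -> T -> R) : Prop :=
  (forall s : R, 0 <= s -> measurable_fun [set: T] (X s)) /\
  {ae P, forall w, cadlag (X ^~ w)}.

(* Weak convergence in D([0, +oo[, R) of the laws of the processes X i to the
   law of Y. Paths that are not cadlag form a negligible set, on which the
   value of F is immaterial. *)
Definition skorokhod_cvg_in_law {I : Type}
    {d} {T : measurableType d} (P : probability T R)
    {d'} {T' : measurableType d'} (P' : probability T' R)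
    (X : I -> R -> T -> R) (G : set_system I) (Y : R -> T' -> R) : Prop :=
  [/\ \forall i \near G, cadlag_process P (X i),
      cadlag_process P' Y &
      forall F : (R -> R) -> R,
        bounded_functional F -> skorokhod_continuous F ->
        'E_P[fun w => F (X i ^~ w)]%E @[i --> G] -->
        'E_P'[fun w => F (Y ^~ w)]%E ].

End Skorokhod.

(* Main.v *)
Require Import Defs.
From mathcomp Require Import all_boot all_order all_algebra.
From mathcomp Require Import complex.
From mathcomp Require Import all_classical all_reals all_analysis.
From mathcomp Require Import measurable_realfun.
From mathcomp Require Import ring lra.

Import Order.TTheory GRing.Theory Num.Theory.
Import numFieldNormedType.Exports.

Local Open Scope classical_set_scope.
Local Open Scope ring_scope.
Local Open Scope complex_scope.

(** Since [Z] starts at 1, [log |Z_r| = Re W_r + O(|W_r|^2 + r)] for small [r].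
    After the time change [r = s t] and division by [sqrt t], the main term is
    a Brownian motion whose law does not depend on [t], and the remainder is of
    order [sqrt t] on bounded time intervals.  Two points need an argument.

    Passing from paths to laws.  The remainder is small for the path of
    [W_(s t) / sqrt t], which varies with [t], whereas a bounded continuous
    functional is only continuous, not uniformly so.  The remedy is to replace
    [W_(s t) / sqrt t] by [W] itself, which has the same law.  That the two give
    the same expectations is seen by discretisation: the increments of the
    driving motion over a grid are rounded to a finite set of values, [Z] is
    replaced by the Euler scheme driven by the rounded increments, and paths are
    replaced by step functions.  A functional of such a path is a random variable
    with finitely many values, and its expectation is an explicit finite sum
    ([expectation_planar_word]) that involves only the mesh and the Gaussian
    probabilities of the rounding cells; Brownian scaling is the scaling of
    Gaussian measures ([normal_prob_scale]).  For fixed [t] the Euler scheme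
    converges to [Z] uniformly on bounded intervals, path by path
    ([grid_cvg_euler]), so the expectation for [Z] at scale [t] is a limit of
    these finite sums ([ou_functional_cvg]).  The same finite sums are
    expectations for the scheme driven by the increments of [W] on the unscaled
    grid; along any [t_j -> 0] with meshes tending to 0, these step paths
    converge to [Re W], again path by path ([grid_cvg_small_time]).  A diagonal
    choice of the meshes yields the theorem with limit [Re W], and the same
    discretisation in dimension one identifies the laws of [Re W] and [beta]
    ([brownian_functional_cvg]).

    The origin is not visited.  The processes have cadlag paths only if
    [log |Z|] stays finite, so it must be shown that [Z] almost surely avoids 0.
    The function [z |-> log (|z|^2 + e)] is subharmonic, hence along the Euler
    chain the mean of [|z|^2 + e - log (|z|^2 + e)] grows at a rate that is
    bounded independently of [e] once the mesh is fine.  This function is at least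
    [log (1 / (2 e))] on the disc of radius [sqrt e], so that the chain enters the
    disc before a fixed time with probability [O(1 / log (1 / e))]
    ([hits_mean_le]).  Letting the mesh and then [e] tend to 0 gives
    [ou_avoids_origin].  Because the increments are rounded, the maximal inequality
    is an induction over finite sums. *)

(** * Rounding to a finite grid *)

Section Quantise.
Context {R : realType}.
Implicit Types (K M : nat) (y : R).

(** Rounding towards zero to a multiple of [1 / K], truncated at [M / K].
    The form with two opposite truncations makes the function odd, so that rounded
    centred Gaussian variables are again symmetric. *)
Definition quantise K M y : R :=
  ((minn (Num.trunc (K%:R * y)) M)%:R - (minn (Num.trunc (- (K%:R * y))) M)%:R)
  / K%:R.

Definition grid_values K M : seq R :=
  undup [seq (i%:R - j%:R) / K%:R | i <- iota 0 M.+1, j <- iota 0 M.+1].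

Lemma quantiseN K M y : quantise K M (- y) = - quantise K M y.
Proof. by rewrite /quantise mulrN opprK -[RHS]mulNr opprB. Qed.

Lemma quantise_in K M y : quantise K M y \in grid_values K M.
Proof.
rewrite mem_undup; apply/allpairsP.
by exists (minn (Num.trunc (K%:R * y)) M, minn (Num.trunc (- (K%:R * y))) M);
  split; rewrite // mem_iota leq0n add0n ltnS geq_minr.
Qed.

Lemma quantise_ge0E K M y : 0 <= y ->
  quantise K M y = (minn (Num.trunc (K%:R * y)) M)%:R / K%:R.
Proof.
move=> y0; rewrite /quantise (_ : Num.trunc (- _) = 0%N) ?min0n ?subr0//.
by apply/eqP; rewrite -leqn0 truncn_le_nat (le_lt_trans _ ltr01)// oppr_le0 mulr_ge0.
Qed.

Lemma quantise_ge0_bounds K M y : (0 < K)%N -> 0 <= y ->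
  0 <= quantise K M y <= y /\
  (K%:R * y <= M%:R -> y - K%:R^-1 <= quantise K M y).
Proof.
move=> K0 y0; have K0' : 0 < K%:R :> R by rewrite ltr0n.
have Ky0 : 0 <= K%:R * y by rewrite mulr_ge0// ltW.
have /andP[t1 t2] := truncn_itv Ky0.
rewrite quantise_ge0E//; split.
  rewrite divr_ge0//= ler_pdivrMr// (mulrC y) (le_trans _ t1)// ler_nat.
  exact: geq_minl.
move=> yM; rewrite ler_pdivlMr// mulrBl mulVf ?gt_eqF//.
have -> : minn (Num.trunc (K%:R * y)) M = Num.trunc (K%:R * y).
  by apply/minn_idPl; rewrite -(ler_nat R) (le_trans t1).
by move: t2; rewrite -natr1 => t2; rewrite (mulrC y) lerBlDr ltW.
Qed.

Lemma norm_quantise_le K M y : (0 < K)%N -> `|quantise K M y| <= `|y|.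
Proof.
move=> K0; have [y0|y0] := leP 0 y.
  have [/andP[q0 qy] _] := quantise_ge0_bounds K M y K0 y0.
  by rewrite !ger0_norm.
have Ny0 : 0 <= - y by rewrite oppr_ge0 ltW.
have [] := quantise_ge0_bounds K M (- y) K0 Ny0.
rewrite quantiseN oppr_ge0 lerN2 => /andP[q0 qy] _.
by rewrite ler0_norm// ltr0_norm// lerN2.
Qed.

Lemma quantise_approx K M y : (0 < K)%N -> K%:R * `|y| <= M%:R ->
  `|quantise K M y - y| <= K%:R^-1.
Proof.
move=> K0; have [y0|y0] := leP 0 y.
  rewrite ger0_norm// => yM.
  have [/andP[q0 qy] /(_ yM) qy'] := quantise_ge0_bounds K M y K0 y0.
  by rewrite distrC ger0_norm ?subr_ge0// lerBlDl -lerBlDr.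
rewrite ltr0_norm// => yM.
have Ny0 : 0 <= - y by rewrite oppr_ge0 ltW.
have [] := quantise_ge0_bounds K M (- y) K0 Ny0.
rewrite quantiseN oppr_ge0 lerN2 => /andP[q0 qy] /(_ yM) qy'.
rewrite ger0_norm ?subr_ge0//; lra.
Qed.

Lemma nondecreasing_quantise K M : nondecreasing_fun (quantise K M).
Proof.
move=> x y xy; rewrite /quantise ler_wpM2r ?invr_ge0// lerB// ler_nat.
  by rewrite leq_min geq_minr andbT (leq_trans (geq_minl _ _))//
    le_truncn// ler_wpM2l.
by rewrite leq_min geq_minr andbT (leq_trans (geq_minl _ _))//
    le_truncn// lerN2 ler_wpM2l.
Qed.

Lemma measurable_quantise K M : measurable_fun setT (quantise K M).
Proof. by apply: nondecreasing_measurable => //; exact: nondecreasing_quantise. Qed.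

Lemma grid_valuesN K M y : (- y \in grid_values K M) = (y \in grid_values K M).
Proof.
suff H z : z \in grid_values K M -> - z \in grid_values K M.
  by apply/idP/idP => [/H|/H//]; rewrite opprK.
rewrite !mem_undup => /allpairsP[[i j] [iM jM ->]].
by apply/allpairsP; exists (j, i); split; rewrite // -mulNr opprB.
Qed.

End Quantise.

(** * The Euler recursion *)

Section Euler.
Context {R : realType}.
Implicit Types (a c : R) (g u x : nat -> R).

Fixpoint euler a c g (k : nat) : R :=
  if k is k'.+1 then a * euler a c g k' + g k' else c.

Lemma eq_euler a c g g' m : (forall i, (i < m)%N -> g i = g' i) ->
  forall k, (k <= m)%N -> euler a c g k = euler a c g' k.
Proof. by move=> gg'; elim=> [//|k IH] km; rewrite /= IH ?gg'// ltnW. Qed.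

Lemma euler_shift a c g k :
  euler a (a * c + g 0%N) (fun i => g i.+1) k = euler a c g k.+1.
Proof. by elim: k => [//|k IH]; rewrite /= IH. Qed.

(** As [0 <= a <= 1], an error is not amplified by later steps: the local defects
    simply add up. *)
Lemma euler_stable a c g u (d : R) m : 0 <= a <= 1 -> u 0%N = c ->
  (forall k, (k < m)%N -> `|u k.+1 - (a * u k + g k)| <= d) ->
  forall k, (k <= m)%N -> `|euler a c g k - u k| <= k%:R * d.
Proof.
move=> /andP[a0 a1] u0 hu; elim=> [_|k IH km].
  by rewrite /= u0 subrr normr0 mul0r.
have -> : euler a c g k.+1 - u k.+1 =
    a * (euler a c g k - u k) - (u k.+1 - (a * u k + g k)) by rewrite /=; ring.
rewrite (le_trans (ler_normB _ _))// -natr1 mulrDl mul1r lerD ?hu//.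
by rewrite normrM (ger0_norm a0) (le_trans (ler_wpM2l a0 (IH (ltnW km))))//
  ler_piMl// (le_trans _ (IH (ltnW km))).
Qed.

(** The chain with drift compared with the drift-free random walk [w]: each step
    contributes the missing drift [(1 - a) (c + s w)]. *)
Lemma euler1_drift a (w g : nat -> R) (c s t : R) m (M : R) :
  0 <= a <= 1 ->
  w = euler 1 0 g ->
  (forall k, (k <= m)%N -> `|w k| <= M) ->
  forall k, (k <= m)%N ->
  `|euler a c (fun i => s * g i) k - (c + s * w k)| <=
    k%:R * ((1 - a) * (`|c| + `|s| * M)).
Proof.
move=> a01 wE wM; apply: euler_stable => //.
  by rewrite wE /= mulr0 addr0.
move=> k km; have := wM k (ltnW km); rewrite {1}wE => wkM.
have -> : c + s * w k.+1 - (a * (c + s * w k) + s * g k) =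
    (1 - a) * (c + s * w k) by rewrite wE /=; ring.
have /andP[_ a1] := a01.
have a10 : 0 <= 1 - a by rewrite subr_ge0.
rewrite normrM (ger0_norm a10) ler_wpM2l//.
rewrite (le_trans (ler_normD _ _))// lerD2l normrM ler_wpM2l//.
by rewrite wE.
Qed.

End Euler.

(** * Logarithmic inequalities *)

Section LogEstimates.
Context {R : realType}.
Implicit Types x y w e u Q b : R.

Lemma ln_ge1BV x : 0 < x -> 1 - x^-1 <= ln x.
Proof.
move=> x0; have xV0 : 0 < x^-1 by rewrite invr_gt0.
have : ln (1 + (x^-1 - 1)) <= x^-1 - 1 by apply: le_ln1Dx; lra.
by rewrite addrC subrK lnV ?posrE//; lra.
Qed.

Lemma ln_le_sub1 x : 0 < x -> ln x <= x - 1.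
Proof.
move=> x0; have : ln (1 + (x - 1)) <= x - 1 by apply: le_ln1Dx; lra.
by rewrite addrC subrK.
Qed.

Lemma ln1D_ge w : - 2^-1 <= w -> w - 2 * w ^+ 2 <= ln (1 + w).
Proof.
move=> w2; have w1 : 0 < 1 + w by lra.
apply: le_trans (ln_ge1BV _ w1).
rewrite -(ler_pM2r w1) [leRHS]mulrBl mulVf ?gt_eqF// mul1r.
nra.
Qed.

Lemma sub_ln_gt0 x : 0 < x -> 0 < x - ln x.
Proof. by move=> /ln_le_sub1; lra. Qed.

(** A quantitative form of the subharmonicity of [z |-> log (|z|^2 + e)].
    With [u = |z|^2 + e], [Q = |g|^2] and [b = 2 z.g], the two logarithms are the
    values at [z + g] and [z - g].  The second-order terms [2 Q / u - b^2 / u^2]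
    have mean [4 v e / u^2 >= 0] for an isotropic [g] with variance [v] per
    coordinate, and the error is of fourth order in [g].  The bound holds for all
    [g]: for [Q > u / 4] the right-hand side is bounded below crudely through
    [(u + Q)^2 - b^2 >= 4 e Q]. *)
Lemma ln_sym_ge e u Q b : 0 < e -> e <= u -> 0 <= Q ->
  b ^+ 2 <= 4 * (u - e) * Q ->
  2 * (Q / u) - b ^+ 2 / u ^+ 2 - 40 * (Q / e) ^+ 2 <=
  ln (u + Q + b) + ln (u + Q - b) - 2 * ln u.
Proof.
move=> e0 eu Q0 bQ; have u0 : 0 < u by rewrite (lt_le_trans e0).
have Pge : 4 * e * Q <= (u + Q) ^+ 2 - b ^+ 2.
  have -> : (u + Q) ^+ 2 = (u - Q) ^+ 2 + 4 * u * Q by ring.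
  have := sqr_ge0 (u - Q); nra.
have P0 : 0 < (u + Q) ^+ 2 - b ^+ 2.
  have -> : (u + Q) ^+ 2 = (u - Q) ^+ 2 + 4 * u * Q by ring.
  have [Q00|] := eqVneq Q 0.
    by move: bQ; rewrite Q00 !mulr0 subr0 addr0 => bQ; have := exprn_gt0 2 u0; lra.
  move=> Qn0; have Qgt0 : 0 < Q by rewrite lt_def Qn0.
  have := mulr_gt0 e0 Qgt0; have := sqr_ge0 (u - Q); nra.
have ub1 : 0 < u + Q + b by nra.
have ub2 : 0 < u + Q - b by nra.
have u20 : 0 < u ^+ 2 by rewrite exprn_gt0.
set W := ((u + Q) ^+ 2 - b ^+ 2) / u ^+ 2.
have W0 : 0 < W by rewrite divr_gt0.
have -> : ln (u + Q + b) + ln (u + Q - b) - 2 * ln u = ln W.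
  rewrite /W ln_div ?posrE// subr_sqr lnM ?posrE// expr2 lnM ?posrE//; ring.
set q := Q / u; set B := b ^+ 2 / u ^+ 2; set r := Q / e.
have q0 : 0 <= q by rewrite divr_ge0// ltW.
have r0 : 0 <= r by rewrite divr_ge0// ltW.
have qr : q <= r by rewrite ler_wpM2l// lef_pV2 ?posrE.
have B0 : 0 <= B by rewrite divr_ge0 ?sqr_ge0.
have Bq : B <= 4 * q.
  rewrite ler_pdivrMr// (le_trans bQ)//.
  have -> : 4 * q * u ^+ 2 = 4 * u * Q by rewrite /q; field; rewrite gt_eqF.
  nra.
have WE : W = 1 + 2 * q + q ^+ 2 - B.
  by rewrite /W /q /B; field; rewrite gt_eqF.
have [Qu|Qu] := leP Q (4^-1 * u).
  have q4 : q <= 4^-1 by rewrite ler_pdivrMr.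
  have : ln (1 + (2 * q - B)) <= ln W.
    by rewrite ler_ln ?posrE//; [rewrite WE; nra|lra].
  apply: le_trans.
  apply: le_trans (ln1D_ge _ _); last by lra.
  nra.
have Weu : e / u <= W.
  rewrite ler_pdivlMr// expr2 mulrA divfK ?gt_eqF//; nra.
apply: le_trans (ln_ge1BV _ W0).
have : W^-1 <= u / e.
  by rewrite -[u / e]invrK lef_pV2 ?posrE ?invr_gt0 ?divr_gt0// invf_div.
have : u / e <= 4 * r.
  rewrite ler_pdivrMr// /r mulrA divfK ?gt_eqF//; nra.
have : 4^-1 <= r by apply: le_trans qr; rewrite ler_pdivlMr// ltW.
nra.
Qed.

End LogEstimates.

(** * Finite words of independent letters *)

Section Words.
Context {R : realType} {S : eqType}.
Implicit Types (vs : seq S) (p : S -> R) (m : nat).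

Fixpoint words vs m : seq (seq S) :=
  if m is m'.+1 then [seq x :: s | x <- vs, s <- words vs m'] else [:: [::]].

Definition word_mean vs p m (G : seq S -> R) : R :=
  \sum_(s <- words vs m) (\prod_(x <- s) p x) * G s.

Lemma word_mean0 vs p G : word_mean vs p 0 G = G [::].
Proof. by rewrite /word_mean /= big_seq1 big_nil mul1r. Qed.

(** Conditioning on the first letter. *)
Lemma word_meanS vs p m G : word_mean vs p m.+1 G =
  \sum_(x <- vs) p x * word_mean vs p m (fun s => G (x :: s)).
Proof.
rewrite /word_mean /= big_allpairs_dep /=; apply: eq_bigr => x _.
by rewrite big_distrr /=; apply: eq_bigr => s _; rewrite big_cons mulrA.
Qed.

Lemma words_uniq vs m : uniq vs -> uniq (words vs m).
Proof.
move=> uvs; elim: m => [//|m IH] /=.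
by apply: allpairs_uniq => // -[x s] [y t] _ _ /= [-> ->].
Qed.

Lemma mem_words vs m s :
  (s \in words vs m) = (size s == m) && all (mem vs) s.
Proof.
elim: m s => [|m IH] s /=; first by case: s => [|x s]; rewrite inE.
case: s => [|x s] /=.
  by apply/negbTE/negP => /allpairsP[[y t] [_ _]].
apply/allpairsP/idP => [[[y t] /= [yv]]|].
  by rewrite IH => /andP[/eqP <- at_] [-> ->]; rewrite eqxx /= yv.
by move=> /and3P[/eqP [ss] xv as_]; exists (x, s); split; rewrite //= IH ss eqxx.
Qed.

Lemma word_mean_cst vs p m (r : R) : \sum_(x <- vs) p x = 1 ->
  word_mean vs p m (fun=> r) = r.
Proof.
move=> p1; elim: m => [|m IH]; first by rewrite word_mean0.
by rewrite word_meanS IH -big_distrl /= p1 mul1r.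
Qed.

End Words.

(** * Hitting probabilities of the Euler chain *)

Section Hitting.
Context {R : realType}.
Variables (vs : seq R) (p : R -> R).
Hypothesis vs_uniq : uniq vs.
Hypothesis vsN : forall x, (- x \in vs) = (x \in vs).
Hypothesis p_ge0 : forall x, 0 <= p x.
Hypothesis pN : forall x, p (- x) = p x.
Hypothesis p1 : \sum_(x <- vs) p x = 1.

Let mean (g : R -> R) := \sum_(x <- vs) p x * g x.
Let mean2 (g : R -> R -> R) := mean (fun x => mean (g x)).

Let meanN g : mean (fun x => g (- x)) = mean g.
Proof.
have pvs : perm_eq [seq - x | x <- vs] vs.
  apply: uniq_perm => //; first by rewrite map_inj_uniq//; exact: oppr_inj.
  move=> x; apply/mapP/idP => [[y yv ->]|xv]; first by rewrite vsN.
  by exists (- x); rewrite ?opprK// vsN.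
rewrite [RHS]/mean -(perm_big _ pvs) big_map.
by apply: eq_bigr => x _; rewrite pN.
Qed.

Let meanD f g : mean (fun x => f x + g x) = mean f + mean g.
Proof. by rewrite /mean -big_split; apply: eq_bigr => x _; rewrite mulrDr. Qed.

Let meanZ k f : mean (fun x => k * f x) = k * mean f.
Proof. by rewrite /mean big_distrr; apply: eq_bigr => x _; rewrite mulrCA. Qed.

Let mean_cst k : mean (fun=> k) = k.
Proof. by rewrite /mean -big_distrl /= p1 mul1r. Qed.

Let eq_mean f g : f =1 g -> mean f = mean g.
Proof. by move=> fg; apply: eq_bigr => x _; rewrite fg. Qed.

Let le_mean f g : (forall x, f x <= g x) -> mean f <= mean g.
Proof. by move=> fg; apply: ler_sum => x _; rewrite ler_wpM2l. Qed.

Let mean2D f g : mean2 (fun x y => f x y + g x y) = mean2 f + mean2 g.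
Proof. by rewrite /mean2 -meanD; apply: eq_mean => x; rewrite meanD. Qed.

Let mean2Z k f : mean2 (fun x y => k * f x y) = k * mean2 f.
Proof. by rewrite /mean2 -meanZ; apply: eq_mean => x; rewrite meanZ. Qed.

Let mean2_cst k : mean2 (fun _ _ => k) = k.
Proof. by rewrite /mean2 !mean_cst. Qed.

Let eq_mean2 f g : (forall x y, f x y = g x y) -> mean2 f = mean2 g.
Proof. by move=> fg; apply: eq_mean => x; apply: eq_mean => y; rewrite fg. Qed.

Let le_mean2 f g : (forall x y, f x y <= g x y) -> mean2 f <= mean2 g.
Proof. by move=> fg; apply: le_mean => x; exact: le_mean. Qed.

Let mean2N g : mean2 (fun x y => g (- x) (- y)) = mean2 g.
Proof.
rewrite /mean2 -(meanN (fun x => mean (g x))); apply: eq_mean => x.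
by rewrite (meanN (g (- x))).
Qed.

Variables (v m4 : R).
Hypothesis m2E : mean (fun x => x ^+ 2) = v.
Hypothesis m4E : mean (fun x => x ^+ 4) <= m4.

Let mean_id : mean id = 0.
Proof.
have := meanN id; rewrite (eq_mean _ (fun x => -1 * x)); last first.
  by move=> x; rewrite mulN1r.
by rewrite meanZ; lra.
Qed.

Let mean2_sqr : mean2 (fun x y => x ^+ 2 + y ^+ 2) = 2 * v.
Proof.
rewrite mean2D /mean2 m2E mean_cst; rewrite (eq_mean _ (fun x => x ^+ 2)).
  by rewrite m2E; ring.
by move=> x; rewrite mean_cst.
Qed.

Let mean2_dot z1 z2 :
  mean2 (fun x y => (z1 * x + z2 * y) ^+ 2) = (z1 ^+ 2 + z2 ^+ 2) * v.
Proof.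
rewrite (eq_mean2 _ (fun x y => z1 ^+ 2 * x ^+ 2 + z2 ^+ 2 * y ^+ 2
   + (2 * z1 * z2) * (x * y))); last by move=> x y; ring.
rewrite !mean2D !mean2Z /mean2 m2E mean_cst.
rewrite [mean (fun x => mean (fun _ => _))](eq_mean _ (fun x => x ^+ 2)).
  rewrite m2E (eq_mean _ (fun=> 0)).
    by rewrite mean_cst; ring.
  by move=> x; rewrite meanZ mean_id mulr0.
by move=> x; rewrite mean_cst.
Qed.

Let mean2_quart : mean2 (fun x y => (x ^+ 2 + y ^+ 2) ^+ 2) <= 4 * m4.
Proof.
have : mean2 (fun x y => (x ^+ 2 + y ^+ 2) ^+ 2) <=
    mean2 (fun x y => 2 * x ^+ 4 + 2 * y ^+ 4).
  apply: le_mean2 => x y.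
  have -> : x ^+ 4 = (x ^+ 2) ^+ 2 by rewrite -exprM.
  have -> : y ^+ 4 = (y ^+ 2) ^+ 2 by rewrite -exprM.
  have := sqr_ge0 (x ^+ 2 - y ^+ 2); nra.
move=> /le_trans; apply.
rewrite mean2D !mean2Z /mean2 mean_cst.
rewrite [mean (fun x => mean (fun _ => _))](eq_mean _ (fun x => x ^+ 4)).
  by have := m4E; lra.
by move=> x; rewrite mean_cst.
Qed.

Variable e : R.
Hypothesis e_gt0 : 0 < e.

(* Averaging over [g] and [- g] cancels the terms of odd order. *)
Let mean2_ln_ge z1 z2 :
  ln (z1 ^+ 2 + z2 ^+ 2 + e) - 80 * m4 / e ^+ 2 <=
  mean2 (fun x y => ln ((z1 + x) ^+ 2 + (z2 + y) ^+ 2 + e)).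
Proof.
set u := z1 ^+ 2 + z2 ^+ 2 + e.
have eu : e <= u by rewrite lerDr addr_ge0 ?sqr_ge0.
have u0 : 0 < u by rewrite (lt_le_trans e_gt0).
set f := fun x y => ln ((z1 + x) ^+ 2 + (z2 + y) ^+ 2 + e).
have -> : mean2 f = 2^-1 * mean2 (fun x y => f x y + f (- x) (- y)).
  by rewrite mean2D mean2N; field.
have H x y : 2 * ln u + (2 / u) * (x ^+ 2 + y ^+ 2) +
     (- 4 / u ^+ 2) * (z1 * x + z2 * y) ^+ 2
     + (- 40 / e ^+ 2) * (x ^+ 2 + y ^+ 2) ^+ 2 <= f x y + f (- x) (- y).
  have Q0 : 0 <= x ^+ 2 + y ^+ 2 by rewrite addr_ge0 ?sqr_ge0.
  have := ln_sym_ge e u (x ^+ 2 + y ^+ 2) (2 * (z1 * x + z2 * y)) e_gt0 eu Q0.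
  have cs : (2 * (z1 * x + z2 * y)) ^+ 2 <= 4 * (u - e) * (x ^+ 2 + y ^+ 2).
    rewrite /u; have := sqr_ge0 (z1 * y - z2 * x); nra.
  move=> /(_ cs).
  have -> : u + (x ^+ 2 + y ^+ 2) + 2 * (z1 * x + z2 * y) =
     (z1 + x) ^+ 2 + (z2 + y) ^+ 2 + e by rewrite /u; ring.
  have -> : u + (x ^+ 2 + y ^+ 2) - 2 * (z1 * x + z2 * y) =
     (z1 - x) ^+ 2 + (z2 - y) ^+ 2 + e by rewrite /u; ring.
  rewrite /f exprMn expr_div_n => h.
  rewrite -subr_ge0; move: h; rewrite -subr_ge0; congr (0 <= _); ring.
have := le_mean2 _ _ H.
rewrite 4!mean2D (mean2Z (2 / u)) (mean2Z (- 4 / u ^+ 2)).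
rewrite (mean2Z (- 40 / e ^+ 2)) mean2_cst mean2_sqr mean2_dot => h.
have uz : z1 ^+ 2 + z2 ^+ 2 <= u by rewrite lerDl ltW.
have v0 : 0 <= v.
  by rewrite -m2E; apply: sumr_ge0 => x _; rewrite mulr_ge0// sqr_ge0.
have h2 : 0 <= 2 / u * (2 * v) + - 4 / u ^+ 2 * ((z1 ^+ 2 + z2 ^+ 2) * v).
  have -> : 2 / u * (2 * v) + - 4 / u ^+ 2 * ((z1 ^+ 2 + z2 ^+ 2) * v) =
     4 * v * (u - (z1 ^+ 2 + z2 ^+ 2)) / u ^+ 2.
    by field; rewrite gt_eqF.
  by rewrite divr_ge0 ?sqr_ge0// mulr_ge0 ?subr_ge0// mulr_ge0.
have h3 : - 40 / e ^+ 2 * mean2 (fun x y => (x ^+ 2 + y ^+ 2) ^+ 2) >=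
   - 160 * m4 / e ^+ 2.
  rewrite [leRHS]mulrAC ler_pM2r ?invr_gt0 ?exprn_gt0//.
  by have := mean2_quart; lra.
lra.
Qed.

Fixpoint hits a z1 z2 (s : seq (R * R)) : bool :=
  (z1 ^+ 2 + z2 ^+ 2 <= e) ||
  (if s is g :: s' then hits a (a * z1 + g.1) (a * z2 + g.2) s' else false).

Lemma hitsP a z1 z2 s :
  reflect (exists2 k, (k <= size s)%N &
    (euler a z1 (fun i => (nth (0, 0) s i).1) k) ^+ 2 +
    (euler a z2 (fun i => (nth (0, 0) s i).2) k) ^+ 2 <= e)
  (hits a z1 z2 s).
Proof.
elim: s z1 z2 => [|g s IH] z1 z2 /=.
  rewrite orbF; apply: (iffP idP) => [h|[[|k]//]].
  by exists 0%N.
apply: (iffP orP) => [[h|/IH[k ks h]]|[[|k] ks h]].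
- by exists 0%N.
- by exists k.+1 => //; rewrite -!euler_shift.
- by left.
- by right; apply/IH; exists k => //; move: h; rewrite -!euler_shift.
Qed.

Let pp (g : R * R) := p g.1 * p g.2.
Let vv := [seq (x, y) | x <- vs, y <- vs].

Let sum_vv (f : R * R -> R) :
  \sum_(g <- vv) pp g * f g = mean2 (fun x y => f (x, y)).
Proof.
rewrite big_allpairs; apply: eq_bigr => x _.
by rewrite big_distrr /=; apply: eq_bigr => y _; rewrite /pp /= mulrA.
Qed.

Variables (a L : R).
Hypothesis a_gt0 : 0 < a.
Hypothesis a_le1 : a <= 1.
Hypothesis L_gt0 : 0 < L.
Hypothesis eL : L <= - ln (2 * e).

(* An upper bound for the mean growth of the potential in one step: [2 v] comes
   from [|z|^2], the second term from the failure of exact subharmonicity, and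
   the last one from the contraction by [a]. *)
Let delta := 2 * v + 80 * m4 / e ^+ 2 - 2 * ln a.

Let potential z1 z2 := z1 ^+ 2 + z2 ^+ 2 + e - ln (z1 ^+ 2 + z2 ^+ 2 + e).

Let v_ge0 : 0 <= v.
Proof. by rewrite -m2E; apply: sumr_ge0 => x _; rewrite mulr_ge0// sqr_ge0. Qed.

Let delta_ge0 : 0 <= delta.
Proof.
have m0 : 0 <= m4.
  apply: le_trans m4E; apply: sumr_ge0 => x _; rewrite mulr_ge0//.
  by rewrite (exprM x 2 2) sqr_ge0.
have : 0 <= 80 * m4 / e ^+ 2 by rewrite divr_ge0 ?sqr_ge0// mulr_ge0.
by have := ln_le0 a_le1; have := v_ge0; rewrite /delta; lra.
Qed.

Let pos_arg z1 z2 : 0 < z1 ^+ 2 + z2 ^+ 2 + e.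
Proof. by have := sqr_ge0 z1; have := sqr_ge0 z2; have := e_gt0; lra. Qed.

Let mean2_potential_le z1 z2 :
  mean2 (fun x y => potential (a * z1 + x) (a * z2 + y)) <=
  potential z1 z2 + delta.
Proof.
have -> : mean2 (fun x y => potential (a * z1 + x) (a * z2 + y)) =
  (a * z1) ^+ 2 + (a * z2) ^+ 2 + 2 * v + e -
  mean2 (fun x y => ln ((a * z1 + x) ^+ 2 + (a * z2 + y) ^+ 2 + e)).
  rewrite (eq_mean2 _ (fun x y => ((a * z1) ^+ 2 + (a * z2) ^+ 2 + e)
     + (x ^+ 2 + y ^+ 2) + (2 * a * z1) * x + (2 * a * z2) * y
     + (-1) * ln ((a * z1 + x) ^+ 2 + (a * z2 + y) ^+ 2 + e))); last first.
    by move=> x y; rewrite /potential; ring.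
  rewrite 4!mean2D 3!mean2Z mean2_cst mean2_sqr.
  have -> : mean2 (fun x y => y) = 0 by rewrite /mean2 mean_id mean_cst.
  have -> : mean2 (fun x y => x) = 0.
    by rewrite -[RHS]mean_id; apply: eq_mean => x; rewrite mean_cst.
  by ring.
have := mean2_ln_ge (a * z1) (a * z2).
have zz : 0 <= z1 ^+ 2 + z2 ^+ 2 by rewrite addr_ge0 ?sqr_ge0.
have aa : a ^+ 2 <= 1 by rewrite exprn_ile1// ltW.
have aa0 : 0 < a ^+ 2 by rewrite exprn_gt0.
have : ln (z1 ^+ 2 + z2 ^+ 2 + e) + 2 * ln a <=
    ln ((a * z1) ^+ 2 + (a * z2) ^+ 2 + e).
  have -> : ln (z1 ^+ 2 + z2 ^+ 2 + e) + 2 * ln a =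
     ln ((z1 ^+ 2 + z2 ^+ 2 + e) * a ^+ 2).
    by rewrite lnM ?posrE// expr2 lnM ?posrE//; ring.
  rewrite ler_ln ?posrE ?mulr_gt0//.
  by rewrite !exprMn -mulrDr mulrDl mulrC lerD2l ler_piMr// ltW.
have : (a * z1) ^+ 2 + (a * z2) ^+ 2 <= z1 ^+ 2 + z2 ^+ 2.
  by rewrite !exprMn -mulrDr ler_piMl.
rewrite /potential /delta; lra.
Qed.

(** The potential [|z|^2 + e - log (|z|^2 + e)] is positive everywhere and at least
    [L] on the disc, and [m delta] compensates its growth over [m] steps; thus the
    right-hand side is a supersolution of the recursion in [m] satisfied by the
    hitting probability.  It is a maximal inequality for supermartingales, proved by
    induction on the number of steps. *)
Lemma hits_mean_le z1 z2 m :
  word_mean vv pp m (fun s => (hits a z1 z2 s)%:R) <=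
  (z1 ^+ 2 + z2 ^+ 2 + e - ln (z1 ^+ 2 + z2 ^+ 2 + e) + m%:R * delta) / L.
Proof.
have pot0 y1 y2 : 0 < potential y1 y2 by apply: sub_ln_gt0.
have pp1 : \sum_(g <- vv) pp g = 1.
  rewrite -[RHS](mean2_cst 1) -(sum_vv (fun=> 1)).
  by apply: eq_bigr => g _; rewrite mulr1.
have small y1 y2 k : y1 ^+ 2 + y2 ^+ 2 <= e ->
    1 <= (potential y1 y2 + k%:R * delta) / L.
  move=> ye; rewrite ler_pdivlMr// mul1r (le_trans eL)//.
  have : ln (y1 ^+ 2 + y2 ^+ 2 + e) <= ln (2 * e).
    by rewrite ler_ln ?posrE ?mulr_gt0//; lra.
  have : 0 <= k%:R * delta by rewrite mulr_ge0.
  by rewrite /potential; have := pos_arg y1 y2; lra.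
rewrite -/(potential z1 z2).
elim: m z1 z2 => [|m IH] z1 z2.
  rewrite word_mean0 [hits _ _ _ _]orbF; case: (leP (z1 ^+ 2 + z2 ^+ 2) e) => [ze|_].
    exact: (small z1 z2 0%N ze).
  by rewrite mul0r addr0 divr_ge0 ?ltW.
have [ze|ze] := leP (z1 ^+ 2 + z2 ^+ 2) e.
  apply: le_trans (small z1 z2 m.+1 ze).
  rewrite le_eqVlt; apply/orP; left; apply/eqP.
  rewrite -[RHS](word_mean_cst vv pp m.+1 1 pp1).
  by apply: eq_bigr => -[|g s] _ /=; rewrite ze.
rewrite word_meanS.
rewrite (eq_bigr (fun g => pp g * (fun g => word_mean vv pp m
   (fun s => (hits a (a * z1 + g.1) (a * z2 + g.2) s)%:R)) g)); last first.
  by move=> g _ /=; rewrite (leNgt _ e) ze.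
rewrite sum_vv /=.
apply: (le_trans (le_mean2 _ _ (fun x y => IH _ _))).
rewrite (eq_mean2 _ (fun x y => L^-1 * potential (a * z1 + x) (a * z2 + y)
   + (m%:R * delta / L))); last by move=> x y; rewrite mulrDl mulrC.
rewrite mean2D (mean2Z L^-1) mean2_cst.
rewrite [L^-1 * _]mulrC -mulrDl ler_pM2r ?invr_gt0// -natr1.
by have := mean2_potential_le z1 z2; lra.
Qed.

End Hitting.

(** * The law of a finite word of independent labels *)

Section LabelLaw.
Context {R : realType} {d : measure_display} {T : measurableType d}.
Variable P : probability T R.
Context {S : eqType}.
Variables (c : nat -> T -> S) (vs : seq S) (p : S -> R).
Hypothesis vs_uniq : uniq vs.
Hypothesis c_in : forall i w, c i w \in vs.

Definition labels (m : nat) (w : T) : seq S := [seq c i w | i <- iota 0 m].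

Definition word_event (s : seq S) : set T := [set w | labels (size s) w = s].

Hypothesis word_event_measurable : forall s, measurable (word_event s).
Hypothesis word_event_prob :
  forall s, all (mem vs) s -> P (word_event s) = (\prod_(x <- s) p x)%:E.

Let labels_words m w : labels m w \in words vs m.
Proof.
rewrite mem_words size_map size_iota eqxx /=; apply/allP => x /mapP[i _ ->].
exact: c_in.
Qed.

Let labels_sum (G : seq S -> R) m w : G (labels m w) =
  \sum_(s <- words vs m) G s * \1_(word_event s) w.
Proof.
rewrite (bigD1_seq (labels m w)) ?words_uniq//=.
rewrite indicE mem_set ?mulr1; last by rewrite /word_event /= size_map size_iota.
rewrite big_seq_cond big1 ?addr0// => s /andP[].
rewrite mem_words => /andP[/eqP sm _] sl; rewrite indicE memNset ?mulr0//.
by rewrite /word_event /= sm => h; rewrite h eqxx in sl.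
Qed.

Lemma measurable_labels (G : seq S -> R) m :
  measurable_fun setT (fun w => G (labels m w)).
Proof.
rewrite (_ : (fun w => _) =
  fun w => \sum_(s <- words vs m) G s * \1_(word_event s) w); last first.
  by apply/funext => w; exact: labels_sum.
apply: measurable_sum => s.
by apply: measurable_funM => //; exact: measurable_indic.
Qed.

(** A function of finitely many finitely-valued labels is a linear combination of
    indicators of words, whatever [G] is. *)
Lemma expectation_labels (G : seq S -> R) m :
  'E_P[fun w => G (labels m w)]%E = (word_mean vs p m G)%:E.
Proof.
rewrite unlock.
under eq_integral do rewrite labels_sum -sumEFin.
rewrite integral_sum//; last first.
  move=> s; under eq_fun do rewrite EFinM.
  by apply: integrableZl => //; exact: integrable_indic.
rewrite -sumEFin big_seq [RHS]big_seq; apply: eq_bigr => s.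
rewrite mem_words => /andP[_ sv].
under eq_integral do rewrite EFinM.
rewrite integralZl//; last exact: integrable_indic.
rewrite integral_indic// setIT mulrC EFinM; congr (_ * _)%E.
exact: word_event_prob.
Qed.

End LabelLaw.

(** * Scaling and moments of Gaussian measures *)

Section NormalScaling.
Context {R : realType}.
Local Notation mu := (@lebesgue_measure R).
Implicit Types (k s : R) (A : set R).

(* The right-hand sides define a measure, namely the image of the Lebesgue measure
   by [y |-> k y] multiplied by [|k|]. *)
Let scaled_lebesgue k :
  exists2 nu : {measure set (measurableTypeR R) -> \bar R},
    (forall A, nu A = `|k|%:E * mu ((fun y => (k * y)%R) @^-1` A))%E &
    forall A (f : R -> \bar R), measurable A -> measurable_fun A f ->
      (forall x, 0 <= f x)%E ->
      (\int[nu]_(x in A) f x =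
       `|k|%:E * \int[mu]_(x in (fun y => (k * y)%R) @^-1` A) f (k * x)%R)%E.
Proof.
pose phi : measurableTypeR R -> measurableTypeR R := fun y => k * y.
have mphi : measurable_fun setT phi by exact: measurable_funM.
have [nu nuE] : exists nu : {measure set (measurableTypeR R) -> \bar R},
    (nu : set _ -> \bar R) = pushforward mu phi.
  by unshelve refine (ex_intro _ _ (erefl (pushforward mu _))).
exists (mscale (NngNum (normr_ge0 k)) nu) => [A|A f mA mf f0].
  by congr (_ * _)%E; exact: (congr1 (fun m => m A) nuE).
rewrite ge0_integral_mscale//; congr (_ * _)%E.
by rewrite nuE (ge0_integral_pushforward mphi mu).
Qed.

Lemma lebesgue_measure_scale k A : k != 0 -> measurable A ->
  (`|k|%:E * mu ((fun y => (k * y)%R) @^-1` A) = mu A)%E.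
Proof.
move=> k0 mA; have nk0 : 0 < `|k| by rewrite normr_gt0.
have [nu nuE _] := scaled_lebesgue k.
rewrite -nuE; apply/esym/lebesgue_measure_unique => // X [[a b] /= ab <-].
rewrite nuE.
have [k_gt0|] := ltP 0 k.
  have -> : (fun y => k * y) @^-1` `]a, b] = `]a / k, b / k]%classic :> set R.
    by apply/seteqP; split => y /=; rewrite !in_itv /= ltr_pdivrMr// ler_pdivlMr//
      (mulrC y).
  rewrite !lebesgue_measure_itv /= !lte_fin ltr_pM2r ?invr_gt0//.
  case: ifP => _; last by rewrite mule0.
  by rewrite -!EFinD -EFinM -mulrBl gtr0_norm// mulrC divfK.
rewrite le_eqVlt (negbTE k0) /= => k_lt0.
have -> : (fun y => k * y) @^-1` `]a, b] = `[b / k, a / k[%classic :> set R.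
  by apply/seteqP; split => y /=; rewrite !in_itv /= ltr_ndivlMr// ler_ndivrMr//
    (mulrC y) andbC.
rewrite !lebesgue_measure_itv /= !lte_fin ltr_nM2r ?invr_lt0//.
case: ifP => _; last by rewrite mule0.
rewrite -!EFinD -EFinM -mulrBl ltr0_norm// mulrC mulrN divfK//.
by rewrite opprB.
Qed.

Lemma normal_pdf_scale k s y : k != 0 -> s != 0 ->
  normal_pdf 0 s y = `|k| * normal_pdf 0 (k * s) (k * y).
Proof.
move=> k0 s0; rewrite !normal_pdfE ?mulf_neq0//.
rewrite /normal_peak /normal_fun !subr0 mulrA; congr (_ * expR _).
  rewrite (_ : (k * s) ^+ 2 * pi *+ 2 = k ^+ 2 * (s ^+ 2 * pi *+ 2)); last first.
    by rewrite exprMn -mulrA mulrnAr.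
  by rewrite sqrtrM ?sqr_ge0// sqrtr_sqr invfM mulrA divff ?mul1r// normr_eq0.
rewrite -mulrnAr !exprMn; field; rewrite ?mulf_neq0 ?k0 ?s0//.
Qed.

(** If [Y] is centred Gaussian with variance [s^2], then [k Y] has variance
    [(k s)^2].  Only the square of the second parameter enters the density, so that
    [k = - 1] expresses the symmetry of the law. *)
Lemma normal_prob_scale k s A : k != 0 -> s != 0 -> measurable A ->
  normal_prob 0 s ((fun y => k * y) @^-1` A) = normal_prob 0 (k * s) A.
Proof.
move=> k0 s0 mA; rewrite /normal_prob.
have nk0 : 0 < `|k| by rewrite normr_gt0.
have mpdf : measurable_fun setT (EFin \o normal_pdf 0 (k * s)).
  by apply/measurable_EFinP; exact: measurable_normal_pdf.
have mk : measurable_fun [set: R] (fun y : R => k * y) by exact: measurable_funM.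
have mphi : measurable ((fun y => k * y) @^-1` A).
  by rewrite -[X in measurable X]setTI; exact: mk.
have [nu nuE nu_int] := scaled_lebesgue k.
have -> : (\int[mu]_(x in A) (normal_pdf 0 (k * s) x)%:E =
           \int[nu]_(x in A) (normal_pdf 0 (k * s) x)%:E)%E.
  apply: eq_measure_integral => X mX XA; rewrite nuE.
  by rewrite lebesgue_measure_scale.
rewrite nu_int//; last 2 first.
- by apply: measurable_funTS.
- by move=> x; rewrite lee_fin normal_pdf_ge0.
rewrite -ge0_integralZl//; last 2 first.
- by apply: measurable_funTS; exact: (measurableT_comp mpdf).
- by move=> x _; rewrite lee_fin normal_pdf_ge0.
by apply: eq_integral => x _; rewrite /= (normal_pdf_scale k)// EFinM.
Qed.

Lemma normal_probN s A : s != 0 -> measurable A ->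
  normal_prob 0 s (-%R @^-1` A) = normal_prob 0 s A.
Proof.
move=> s0 mA; rewrite (_ : -%R = fun y => -1 * y); last first.
  by apply/funext => y; rewrite mulN1r.
rewrite normal_prob_scale// ?oppr_eq0 ?oner_eq0// mulN1r /normal_prob.
apply: eq_integral => x _; rewrite !normal_pdfE ?oppr_eq0//.
by rewrite /normal_peak /normal_fun !sqrrN.
Qed.

End NormalScaling.

(** The law of a rounded centred Gaussian variable [q Y], as weights on the finite
    set [vs] of values of [q]. *)
Section NormalCells.
Context {R : realType}.
Variables (q : R -> R) (vs : seq R).
Hypothesis mq : measurable_fun setT q.
Hypothesis q_in : forall y, q y \in vs.
Hypothesis vs_uniq : uniq vs.
Implicit Types s c : R.

Definition cell_prob s c : R := fine (normal_prob 0 s (q @^-1` [set c])).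

Let mcell c : measurable (q @^-1` [set c]).
Proof. by rewrite -[X in measurable X]setTI; exact: mq. Qed.

Lemma cell_probE s c : (cell_prob s c)%:E = normal_prob 0 s (q @^-1` [set c]).
Proof. by rewrite /cell_prob fineK// fin_num_measure//; exact: mcell. Qed.

Lemma cell_prob_ge0 s c : 0 <= cell_prob s c.
Proof. by rewrite -lee_fin cell_probE. Qed.

Lemma cell_prob_sum s : \sum_(c <- vs) cell_prob s c = 1.
Proof.
apply: EFin_inj; rewrite -sumEFin.
transitivity (\int[normal_prob 0 s]_y (cst 1 y))%E; last first.
  by rewrite integral_cst// mul1e; exact: probability_setT.
transitivity (\int[normal_prob 0 s]_y
    (\sum_(c <- vs) (\1_(q @^-1` [set c]) y)%:E))%E.
  rewrite integral_sum//; last first.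
    by move=> c; apply: integrable_indic; exact: mcell.
  by apply: eq_bigr => c _; rewrite cell_probE integral_indic ?setIT//; exact: mcell.
apply: eq_integral => y _; rewrite sumEFin (bigD1_seq (q y))//=.
rewrite indicE mem_set//= big_seq_cond big1 ?addr0// => c /andP[_ cq].
by rewrite indicE memNset//= => qc; rewrite qc eqxx in cq.
Qed.

Lemma cell_probN s c : s != 0 -> (forall y, q (- y) = - q y) ->
  cell_prob s (- c) = cell_prob s c.
Proof.
move=> s0 qN; apply: EFin_inj.
rewrite !cell_probE -[RHS](normal_probN s _ s0 (mcell c)).
congr (normal_prob _ _ _); apply/seteqP; split => y /=; rewrite qN.
  by move=> ->; rewrite opprK.
by move=> <-; rewrite opprK.
Qed.

(* A fourth power costs a constant and a factor [sqrt 2] on the standard deviation: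
   with [u = y^2 / (4 s^2)], the density is proportional to [exp (- 2 u)] and
   [u^2 exp (- u)] is bounded by 4. *)
Let quart_pdf_le s y : s != 0 -> y ^+ 4 * normal_pdf 0 s y <=
  128 * s ^+ 4 * normal_pdf 0 (Num.sqrt 2 * s) y.
Proof.
move=> s0; have r0 : Num.sqrt 2 != 0 :> R by rewrite gt_eqF// sqrtr_gt0.
rewrite !normal_pdfE ?mulf_neq0//.
have -> : normal_peak (Num.sqrt 2 * s) = (Num.sqrt 2)^-1 * normal_peak s.
  rewrite /normal_peak -invfM exprMn sqr_sqrtr// -mulrA -mulrnAr sqrtrM//.
set u := y ^+ 2 / (4 * s ^+ 2).
have s2 : 0 < s ^+ 2 by rewrite exprn_even_gt0.
have fE : normal_fun 0 s y = expR (- u) * expR (- u).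
  rewrite /normal_fun subr0 -expRD; congr expR; rewrite /u.
  by field.
have gE : normal_fun 0 (Num.sqrt 2 * s) y = expR (- u).
  rewrite /normal_fun subr0 exprMn sqr_sqrtr//; congr expR; rewrite /u.
  by field.
rewrite fE gE.
have u0 : 0 <= u by rewrite divr_ge0 ?sqr_ge0// mulr_ge0// ltW.
have ule : u ^+ 2 * expR (- u) <= 4.
  have e1 := expR_ge1Dx (u / 2).
  have eE : expR u = expR (u / 2) ^+ 2 by rewrite expr2 -expRD -splitr.
  rewrite expRN ler_pdivrMr ?expR_gt0// eE.
  have : (1 + u / 2) ^+ 2 <= expR (u / 2) ^+ 2.
    by rewrite ler_pXn2r ?nnegrE ?expR_ge0// addr_ge0// divr_ge0.
  nra.
have r2 : Num.sqrt 2 <= 2 :> R.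
  by rewrite -(@ler_pXn2r _ 2)// ?nnegrE ?sqrtr_ge0// sqr_sqrtr// expr2; lra.
have yE : y ^+ 4 = 16 * s ^+ 4 * u ^+ 2 by rewrite /u; field.
have pk := normal_peak_ge0 s.
have e0 := expR_ge0 (- u).
have s4 : 0 <= s ^+ 4 by rewrite (exprM s 2 2) sqr_ge0.
have -> : y ^+ 4 * (normal_peak s * (expR (- u) * expR (- u))) =
   16 * (u ^+ 2 * expR (- u)) * (s ^+ 4 * normal_peak s * expR (- u)).
  by rewrite yE; ring.
have -> : 128 * s ^+ 4 * ((Num.sqrt 2)^-1 * normal_peak s * expR (- u)) =
   (128 * (Num.sqrt 2)^-1) * (s ^+ 4 * normal_peak s * expR (- u)) by ring.
apply: ler_wpM2r; first by apply: mulr_ge0 => //; exact: mulr_ge0.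
have : 2^-1 <= (Num.sqrt 2)^-1 :> R by rewrite lef_pV2 ?posrE ?sqrtr_gt0.
lra.
Qed.

(** The weights for [s], multiplied by [c^4], are dominated cell by cell by those for
    [sqrt 2 s], whose total mass is 1. *)
Lemma cell_prob_quart s : s != 0 -> (forall y, `|q y| <= `|y|) ->
  \sum_(c <- vs) cell_prob s c * c ^+ 4 <= 128 * s ^+ 4.
Proof.
move=> s0 qle; pose s' := Num.sqrt 2 * s.
have -> : 128 * s ^+ 4 = 128 * s ^+ 4 * \sum_(c <- vs) cell_prob s' c.
  by rewrite cell_prob_sum mulr1.
rewrite big_distrr /=.
apply: ler_sum => c _; rewrite -lee_fin mulrC EFinM [leRHS]EFinM !cell_probE.
have s4 : 0 <= s ^+ 4 by rewrite (exprM s 2 2) sqr_ge0.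
have c4 (z : R) : 0 <= z ^+ 4 by rewrite (exprM z 2 2) sqr_ge0.
have mpdf z : measurable_fun (q @^-1` [set c]) (EFin \o normal_pdf 0 z).
  by apply: measurable_funTS; apply/measurable_EFinP; exact: measurable_normal_pdf.
have scale (k z : R) : 0 <= k ->
    (k%:E * normal_prob 0 z (q @^-1` [set c]) =
     \int[lebesgue_measure]_(y in q @^-1` [set c]) (k * normal_pdf 0 z y)%:E)%E.
  move=> k0; rewrite /normal_prob -ge0_integralZl//.
  - exact: mcell.
  - exact: mpdf.
  - by move=> y _; rewrite lee_fin normal_pdf_ge0.
have s4' : 0 <= 128 * s ^+ 4 by apply: mulr_ge0.
rewrite (scale _ _ (c4 c)) (scale _ _ s4').
apply: ge0_le_integral.
- exact: mcell.
- by move=> y _; rewrite lee_fin mulr_ge0 ?normal_pdf_ge0.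
- by apply/measurable_EFinP; apply: measurable_funM => //;
    apply/measurable_EFinP; exact: mpdf.
- by apply/measurable_EFinP; apply: measurable_funM => //;
    apply/measurable_EFinP; exact: mpdf.
move=> y /= qy; rewrite lee_fin.
apply: le_trans (quart_pdf_le s y s0).
rewrite ler_wpM2r ?normal_pdf_ge0//.
have := qle y; rewrite qy => cy.
rewrite (exprM c 2 2) (exprM y 2 2) ler_pXn2r ?nnegrE ?sqr_ge0//.
by rewrite -ler_sqrt ?sqr_ge0// !sqrtr_sqr.
Qed.

Lemma cell_prob_sqr s : s != 0 -> (forall y, `|q y| <= `|y|) ->
  \sum_(c <- vs) cell_prob s c * c ^+ 2 <= 65 * s ^+ 2.
Proof.
move=> s0 qle; have s2 : 0 < s ^+ 2 by rewrite exprn_even_gt0.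
have h := cell_prob_quart s s0 qle.
suff : \sum_(c <- vs) cell_prob s c * c ^+ 2 <=
   \sum_(c <- vs) (2^-1 * s ^+ 2 * cell_prob s c +
     (2^-1 / s ^+ 2) * (cell_prob s c * c ^+ 4)).
  rewrite big_split /= -!big_distrr /= cell_prob_sum => /le_trans; apply.
  have : 2^-1 / s ^+ 2 * (\sum_(c <- vs) cell_prob s c * c ^+ 4) <=
      2^-1 / s ^+ 2 * (128 * s ^+ 4).
    by rewrite ler_wpM2l// divr_ge0// ltW.
  have -> : 2^-1 / s ^+ 2 * (128 * s ^+ 4) = 64 * s ^+ 2 by field.
  lra.
apply: ler_sum => c _.
have -> : 2^-1 * s ^+ 2 * cell_prob s c + 2^-1 / s ^+ 2 * (cell_prob s c * c ^+ 4)
  = cell_prob s c * (2^-1 * (s ^+ 2 + c ^+ 4 / s ^+ 2)) by field.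
rewrite ler_wpM2l ?cell_prob_ge0//.
have := sqr_ge0 (s - c ^+ 2 / s).
have -> : (s - c ^+ 2 / s) ^+ 2 = s ^+ 2 + c ^+ 4 / s ^+ 2 - 2 * c ^+ 2 by field.
lra.
Qed.

End NormalCells.

(** * Rounded Brownian increments *)

Section GridIncrements.
Context {R : realType}.
Implicit Types (t : R) (n i : nat).

(** The precision [n^-3] is chosen so that the [N n] rounding errors committed up to
    a fixed time [N], on a grid of mesh [1 / n], add up to [O(n^-2)], while the
    truncation at [n] is eventually harmless on a bounded path. *)
Definition resolve n (y : R) : R := quantise (n ^ 3) (n ^ 4) y.

Definition resolve_values n : seq R := grid_values (n ^ 3) (n ^ 4).

Definition grid_time t n i : R := t * i%:R / n%:R.

Definition grid_increment t n (x : R -> R) i : R :=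
  (Num.sqrt t)^-1 * (x (grid_time t n i.+1) - x (grid_time t n i)).

Definition grid_code t n (x : R -> R) i : R := resolve n (grid_increment t n x i).

(** The normalised increments over the mesh [t / n] have variance [1 / n] for every
    [t], so that these weights do not depend on [t]. *)
Definition step_prob n (c : R) : R :=
  cell_prob (resolve n) (Num.sqrt n%:R^-1) c.

Lemma grid_time_ge0 t n i : 0 <= t -> 0 <= grid_time t n i.
Proof. by move=> t0; rewrite /grid_time divr_ge0// mulr_ge0. Qed.

Lemma le_grid_time t n i j : 0 <= t -> (i <= j)%N ->
  grid_time t n i <= grid_time t n j.
Proof.
by move=> t0 ij; rewrite /grid_time ler_wpM2r ?invr_ge0// ler_wpM2l// ler_nat.
Qed.

Lemma grid_timeS t n i : grid_time t n i.+1 = grid_time t n i + t / n%:R.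
Proof. by rewrite /grid_time -natr1; ring. Qed.

Lemma measurable_resolve n : measurable_fun setT (resolve n).
Proof. exact: measurable_quantise. Qed.

End GridIncrements.

Section BrownianLaw.
Context {R : realType}.

Lemma measurable_grid_increment {d} {T : measurableType d} (X : R -> T -> R)
    (t : R) n i : 0 <= t ->
  (forall s, 0 <= s -> measurable_fun setT (X s)) ->
  measurable_fun setT (fun w => grid_increment t n (X ^~ w) i).
Proof.
move=> t0 mX; apply: measurable_funM => //.
by apply: measurable_funB; apply: mX; exact: grid_time_ge0.
Qed.

Lemma measurable_grid_word {d} {T : measurableType d} (X : R -> T -> R) (t : R) n
    (s : seq R) : 0 <= t ->
  (forall s, 0 <= s -> measurable_fun setT (X s)) ->
  measurable (word_event (fun i w => grid_code t n (X ^~ w) i) s).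
Proof.
move=> t0 mX.
rewrite (_ : word_event _ _ = \big[setI/setT]_(i < size s)
   ((fun w => grid_code t n (X ^~ w) i) @^-1` [set nth 0 s i])); last first.
  apply/seteqP; split => w;
    rewrite -(bigcap_mkord _ (fun i => (fun w => grid_code t n (X ^~ w) i) @^-1`
      [set nth 0 s i])) /word_event /labels /=.
    move=> ws i /= im; move/(congr1 (nth 0 ^~ i)): ws.
    by rewrite (nth_map 0%N) ?size_iota// nth_iota.
  move=> h; apply: (@eq_from_nth _ 0); rewrite size_map size_iota// => i im.
  by rewrite (nth_map 0%N) ?size_iota// nth_iota// add0n; exact: h.
apply: bigsetI_measurable => i _; rewrite -[X in measurable X]setTI.
apply: (measurableT_comp (@measurable_resolve R n)) => //.
exact: measurable_grid_increment.
Qed.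

Context {d : measure_display} {T : measurableType d}.
Variable P : probability T R.
Implicit Types (X Y : R -> T -> R).

Lemma grid_word_prob X (t : R) n (s : seq R) : brownian P X -> 0 < t -> (0 < n)%N ->
  P (word_event (fun i w => grid_code t n (X ^~ w) i) s) =
  (\prod_(c <- s) step_prob n c)%:E.
Proof.
move=> [mX _ indX lawX _] t0 n0.
have rt0 : 0 < Num.sqrt t by rewrite sqrtr_gt0.
have n0' : 0 < n%:R :> R by rewrite ltr0n.
pose B (i : 'I_(size s)) : set R :=
  (fun y => (Num.sqrt t)^-1 * y) @^-1` (resolve n @^-1` [set nth 0 s i]).
have mcell c : measurable (resolve n @^-1` [set c] : set R).
  by rewrite -[X in measurable X]setTI; exact: measurable_resolve.
have mB i : measurable (B i).
  rewrite /B -[X in measurable X]setTI.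
  have mk : measurable_fun [set: R] (fun y : R => (Num.sqrt t)^-1 * y).
    exact: measurable_funM.
  exact: mk.
have -> : word_event (fun i w => grid_code t n (X ^~ w) i) s =
  \bigcap_(i in [set: 'I_(size s)]) ((fun w => X (grid_time t n i.+1) w -
     X (grid_time t n i) w) @^-1` B i).
  apply/seteqP; split => w; rewrite /word_event /labels /B /=.
    move=> ws i _ /=; move/(congr1 (nth 0 ^~ i)): ws.
    by rewrite (nth_map 0%N) ?size_iota// nth_iota.
  move=> h; apply: (@eq_from_nth _ 0); rewrite size_map size_iota// => i im.
  rewrite (nth_map 0%N) ?size_iota// nth_iota// add0n.
  exact: (h (Ordinal im) I).
rewrite (indX _ (grid_time t n)) //; first last.
- by move=> i; apply: le_grid_time; [exact: ltW|exact: leqnSn].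
- by apply: grid_time_ge0; exact: ltW.
rewrite (eq_bigr (fun i : 'I_(size s) => (step_prob n (nth 0 s i))%:E)); last first.
  move=> i _; rewrite lawX//; first last.
  - by rewrite grid_timeS ltrDl divr_gt0.
  - by apply: grid_time_ge0; exact: ltW.
  rewrite grid_timeS addrAC subrr add0r /B normal_prob_scale//; last 2 first.
  - by rewrite gt_eqF// invr_gt0.
  - by rewrite gt_eqF// sqrtr_gt0 divr_gt0.
  rewrite /step_prob cell_probE; last exact: measurable_resolve.
  by rewrite sqrtrM ?ltW// mulrA mulVf ?gt_eqF// mul1r.
by rewrite prodEFin (big_nth 0) big_mkord.
Qed.

Definition planar_code (t : R) n (W : R -> R[i]) i : R * R :=
  (grid_code t n (fun s => complex.Re (W s)) i,
   grid_code t n (fun s => complex.Im (W s)) i).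

Definition planar_step_prob n (c : R * R) : R := step_prob n c.1 * step_prob n c.2.

Definition planar_values n : seq (R * R) :=
  [seq (x, y) | x <- resolve_values n, y <- resolve_values n].

Lemma planar_wordE (W : R -> T -> R[i]) (t : R) n (s : seq (R * R)) :
  word_event (fun i w => planar_code t n (W ^~ w) i) s =
  word_event (fun i w => grid_code t n (fun u => complex.Re (W u w)) i) (unzip1 s) `&`
  word_event (fun i w => grid_code t n (fun u => complex.Im (W u w)) i) (unzip2 s).
Proof.
apply/seteqP; split => w; rewrite /word_event /labels /planar_code /= !size_map.
  by move=> <-; rewrite /unzip1 /unzip2 -!map_comp size_map size_iota.
move=> [h1 h2]; rewrite -[RHS]zip_unzip -h1 -h2.
by elim: (iota _ _) => //= a r ->.
Qed.

Lemma measurable_planar_word (W : R -> T -> R[i]) (t : R) n (s : seq (R * R)) :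
  planar_brownian P W -> 0 < t ->
  measurable (word_event (fun i w => planar_code t n (W ^~ w) i) s).
Proof.
move=> [[mX _ _ _ _] [mY _ _ _ _] _] t0; rewrite planar_wordE.
apply: measurableI.
  by apply: (measurable_grid_word (fun u w => complex.Re (W u w))) => //; exact: ltW.
by apply: (measurable_grid_word (fun u w => complex.Im (W u w))) => //; exact: ltW.
Qed.

(** The measurability of the word events is applied here to the sigma-algebra
    generated by the process alone. *)
Lemma grid_word_process_event X (t : R) n (s : seq R) : 0 <= t ->
  process_events X (word_event (fun i w => grid_code t n (X ^~ w) i) s).
Proof.
move=> t0; rewrite /process_events; set G := (X in <<s X >>).
apply: (@measurable_grid_word _ (g_sigma_algebraType G) X) => // r r0 _ B mB.
apply: sub_sigma_algebra; rewrite setTI; exists r; split => //.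
by exists B.
Qed.

Lemma planar_word_prob (W : R -> T -> R[i]) (t : R) n (s : seq (R * R)) :
  planar_brownian P W -> 0 < t -> (0 < n)%N ->
  P (word_event (fun i w => planar_code t n (W ^~ w) i) s) =
  (\prod_(c <- s) planar_step_prob n c)%:E.
Proof.
move=> [bX bY indXY] t0 n0; rewrite planar_wordE.
rewrite indXY; first last.
- exact: (grid_word_process_event (fun u w => complex.Im (W u w)) _ _ _ (ltW t0)).
- exact: (grid_word_process_event (fun u w => complex.Re (W u w)) _ _ _ (ltW t0)).
rewrite (grid_word_prob (fun u w => complex.Re (W u w)))//.
rewrite (grid_word_prob (fun u w => complex.Im (W u w)))//.
by rewrite -EFinM /unzip1 /unzip2 !big_map -big_split.
Qed.

Lemma resolve_values_uniq n : uniq (@resolve_values R n).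
Proof. exact: undup_uniq. Qed.

Lemma planar_values_uniq n : uniq (planar_values n).
Proof.
by apply: allpairs_uniq; rewrite ?resolve_values_uniq// => -[x s] [y t] _ _ /= [-> ->].
Qed.

Lemma grid_code_in t n x i : grid_code t n x i \in @resolve_values R n.
Proof. exact: quantise_in. Qed.

Lemma planar_code_in t n W i : planar_code t n W i \in planar_values n.
Proof.
by apply/allpairsP; exists (planar_code t n W i); split => //; exact: grid_code_in.
Qed.

Lemma expectation_grid_word X (t : R) n m (G : seq R -> R) :
  brownian P X -> 0 < t -> (0 < n)%N ->
  measurable_fun setT (fun w => G (mkseq (grid_code t n (X ^~ w)) m)) /\
  'E_P[fun w => G (mkseq (grid_code t n (X ^~ w)) m)]%E =
  (word_mean (resolve_values n) (step_prob n) m G)%:E.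
Proof.
move=> bX t0 n0; have [mX _ _ _ _] := bX.
have mw s : measurable (word_event (fun i w => grid_code t n (X ^~ w) i) s).
  by apply: measurable_grid_word => //; exact: ltW.
split; first apply: (measurable_labels (fun i w => grid_code t n (X ^~ w) i)
  _ (resolve_values_uniq n)) => //.
  by move=> i w; exact: grid_code_in.
apply: (expectation_labels P (fun i w => grid_code t n (X ^~ w) i) _ _
  (resolve_values_uniq n)) => //.
  by move=> i w; exact: grid_code_in.
by move=> s _; exact: grid_word_prob.
Qed.

Lemma expectation_planar_word (W : R -> T -> R[i]) (t : R) n m
    (G : seq (R * R) -> R) :
  planar_brownian P W -> 0 < t -> (0 < n)%N ->
  measurable_fun setT (fun w => G (mkseq (planar_code t n (W ^~ w)) m)) /\
  'E_P[fun w => G (mkseq (planar_code t n (W ^~ w)) m)]%E =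
  (word_mean (planar_values n) (planar_step_prob n) m G)%:E.
Proof.
move=> bW t0 n0.
have mw s : measurable (word_event (fun i w => planar_code t n (W ^~ w) i) s).
  exact: measurable_planar_word.
split; first apply: (measurable_labels (fun i w => planar_code t n (W ^~ w) i)
  _ (planar_values_uniq n)) => //.
  by move=> i w; exact: planar_code_in.
apply: (expectation_labels P (fun i w => planar_code t n (W ^~ w) i) _ _
  (planar_values_uniq n)) => //.
  by move=> i w; exact: planar_code_in.
by move=> s _; exact: planar_word_prob.
Qed.

End BrownianLaw.

(** * Continuous paths *)

Section ContinuousPaths.
Context {R : realType}.
Implicit Types (x f : R -> R).

Lemma continuous_pathP f : continuous_path f <->
  forall s e : R, 0 <= s -> 0 < e -> exists2 r, 0 < r &
    forall s', 0 <= s' -> `|s - s'| < r -> `|f s - f s'| < e.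
Proof.
have in0 (s : R) : (s \in `[0, +oo[) = (0 <= s) by rewrite in_itv /= andbT.
rewrite /continuous_path; split.
  move=> /subspace_continuousP fc s e s0 e0.
  have /cvgrPdist_lt/(_ _ e0) : f @ within `[0, +oo[%classic (nbhs s) --> f s.
    by apply: fc; rewrite /= in0.
  rewrite near_withinE => /nbhs_ballP[r r0 rP].
  by exists r => // s' s'0 ss'; apply: rP => //=; rewrite in0.
move=> fP; apply/subspace_continuousP => s; rewrite /= in0 => s0.
apply/cvgrPdist_lt => e e0; have [r r0 rP] := fP s e s0 e0.
rewrite near_withinE; apply/nbhs_ballP; exists r => //= s' ss'.
by rewrite in0 => s'0; exact: rP.
Qed.

Lemma continuous_path_within f (b : R) : continuous_path f ->
  {within `[0, b], continuous f}.
Proof.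
apply: continuous_subspaceW => s /=; rewrite !in_itv /= andbT.
by case/andP.
Qed.

Lemma continuous_path_bounded f (b : R) : continuous_path f ->
  exists2 M, 0 < M & forall s, 0 <= s <= b -> `|f s| <= M.
Proof.
move=> cf; have [b0|b0] := leP 0 b; last first.
  exists 1 => // s /andP[s0 sb].
  by have := le_lt_trans (le_trans s0 sb) b0; rewrite ltxx.
have [c1 _ h1] := EVT_max b0 (continuous_path_within f b cf).
have [c2 _ h2] := EVT_min b0 (continuous_path_within f b cf).
exists (1 + `|f c1| + `|f c2|) => [|s sb].
  by rewrite -addrA ltr_wpDr// addr_ge0.
have {}h1 := h1 s sb; have {}h2 := h2 s sb.
have := ler_norm (f c1); have := ler_norm (- f c2); rewrite normrN => ? ?.
have ? := normr_ge0 (f c1); have ? := normr_ge0 (f c2).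
by rewrite ler_norml; apply/andP; split; lra.
Qed.

(** Heine's theorem on the segment from 0 to [b], in a form that lets the second
    point leave the segment. *)
Lemma continuous_path_unif f (b e : R) : continuous_path f -> 0 < e ->
  exists2 r, 0 < r & forall s s', 0 <= s <= b -> 0 <= s' ->
    `|s - s'| < r -> `|f s - f s'| < e.
Proof.
move=> /continuous_pathP cf e0.
have /compact_near_coveringP K := @segment_compact R 0 b.
have : \forall r \near (0 : R)^'+, forall s, `[0, b]%classic s -> 0 <= s ->
    forall s', 0 <= s' -> `|s - s'| < r -> `|f s - f s'| < e.
  apply: K => s; rewrite /= in_itv /= => /andP[s0 sb].
  have e2 : 0 < e / 2 by rewrite divr_gt0.
  have [r r0 rP] := cf s (e / 2) s0 e2.
  have r2 : 0 < r / 2 by rewrite divr_gt0.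
  exists (ball s (r / 2), [set r' | r' < r / 2]).
    split => /=; first exact: nbhsx_ballx.
    exact: nbhs_right_lt.
  move=> [s1 r'] [/= ss1 r'r] s10 s' s'0 s1s'.
  rewrite (splitr e) -(subrKA (f s)) (le_lt_trans (ler_normD _ _))// ltrD//.
    rewrite distrC; apply: rP => //; rewrite (lt_trans ss1)// ltr_pdivrMr//.
    by rewrite ltr_pMr// ltr1n.
  apply: rP => //; rewrite (splitr r) -(subrKA s1).
  by rewrite (le_lt_trans (ler_normD _ _))// ltrD// (lt_trans s1s').
move=> H; have [r [rP r0]] := filter_ex (filterI H (nbhs_right_gt (0 : R))).
exists r => // s s' sb; apply: rP; first by rewrite /= in_itv.
by case/andP: sb.
Qed.

Lemma continuous_path_cadlag f : continuous_path f -> cadlag f.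
Proof.
move=> /continuous_pathP cf; split=> [s s0|s s0].
  apply/cvgrPdist_lt => e e0; have [r r0 rP] := cf s e s0 e0.
  near=> s'; apply: rP.
    by apply: (le_trans s0); apply: ltW; near: s'; exact: nbhs_right_gt.
  have ss' : s < s' by near: s'; exact: nbhs_right_gt.
  rewrite distrC gtr0_norm ?subr_gt0// ltrBlDl.
  by near: s'; apply: nbhs_right_lt; rewrite ltrDl.
apply/cvg_ex; exists (f s).
apply/cvgrPdist_lt => e e0; have [r r0 rP] := cf s e (ltW s0) e0.
near=> s'; apply: rP; first by apply: ltW; near: s'; exact: nbhs_left_gt.
have ss' : s' < s by near: s'; exact: nbhs_left_lt.
rewrite gtr0_norm ?subr_gt0// ltrBlDl -ltrBlDr.
by near: s'; apply: nbhs_left_gt; rewrite ltrBlDr ltrDl.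
Unshelve. all: by end_near.
Qed.

Lemma continuous_path_scale f (k : R) : 0 <= k -> continuous_path f ->
  continuous_path (fun s => f (s * k)).
Proof.
rewrite le_eqVlt => /predU1P[<- _|k0 /continuous_pathP cf]; apply/continuous_pathP.
  by move=> s e _ e0; exists 1 => // s' _ _; rewrite !mulr0 subrr normr0.
move=> s e s0 e0; have sk : 0 <= s * k by rewrite mulr_ge0// ltW.
have [r r0 rP] := cf (s * k) e sk e0.
exists (r / k) => [|s' s'0 ss']; first by rewrite divr_gt0.
apply: rP; first by rewrite mulr_ge0// ltW.
by rewrite -mulrBl normrM (gtr0_norm k0) -ltr_pdivlMr.
Qed.

Lemma continuous_path_sqr_add f g : continuous_path f -> continuous_path g ->
  continuous_path (fun s => f s ^+ 2 + g s ^+ 2).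
Proof.
rewrite /continuous_path => cf cg s; apply: cvgD; first by apply: cvgM; exact: cf.
by apply: cvgM; exact: cg.
Qed.

Lemma continuous_path_ln f : continuous_path f -> (forall s, 0 <= s -> 0 < f s) ->
  continuous_path (fun s => ln (f s)).
Proof.
move=> /subspace_continuousP cf f0; apply/subspace_continuousP => s sA.
have s0 : 0 <= s by move: sA; rewrite /= in_itv /= andbT.
by apply: (cvg_comp _ _ (cf s sA)); exact/continuous_ln/f0.
Qed.

End ContinuousPaths.

(** * Convergence of the Euler scheme *)

Section PathIntegral.
Context {R : realType}.
Local Notation mu := (@lebesgue_measure R).
Implicit Types (u : R -> R).

Lemma continuous_path_integrable u (b : R) : continuous_path u ->
  mu.-integrable `[0, b] (EFin \o u).
Proof.
move=> cu; apply: continuous_compact_integrable; first exact: segment_compact.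
exact: continuous_path_within.
Qed.

Lemma path_integral_increment u (a b c e : R) : continuous_path u ->
  0 <= a -> a <= b -> (forall s, a <= s <= b -> `|u s - c| <= e) ->
  `|\int[mu]_(s in `[0, b]) u s - \int[mu]_(s in `[0, a]) u s - (b - a) * c| <=
  (b - a) * e.
Proof.
move=> cu a0 ab ue; have iu := continuous_path_integrable u b cu.
rewrite (Rintegral_itvB iu); rewrite ?bnd_simp//.
have mab : fine (mu `]a, b]) = b - a.
  rewrite lebesgue_measure_itv /= lte_fin; case: ltP => // ba.
  by rewrite (@le_anti _ _ a b) ?subrr// ab ba.
have iu' : mu.-integrable `]a, b] (EFin \o u).
  apply: integrableS iu => //; apply: subset_itv; rewrite bnd_simp//.
have icst k : mu.-integrable `]a, b] (EFin \o (fun=> k)).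
  apply: (@integrableS _ _ _ mu `[a, b]) => //.
    by apply: subset_itv; rewrite bnd_simp.
  apply: continuous_compact_integrable; first exact: segment_compact.
  by apply: continuous_subspaceT => ?; exact: cvg_cst.
rewrite (mulrC (b - a) c) -mab -(@Rintegral_cst _ _ _ mu `]a, b]%classic)//.
rewrite -RintegralB//.
have mI : measurable (`]a, b]%classic : set (measurableTypeR R)) by [].
have iB : mu.-integrable `]a, b] (EFin \o (fun s => u s - c)).
  exact: (integrableB mI iu' (icst c)).
apply: le_trans (le_normr_Rintegral mI iB) _.
rewrite mulrC -(@Rintegral_cst _ _ _ mu `]a, b]%classic)//.
apply: le_Rintegral => //.
  exact: integrable_norm iB.
move=> s /=; rewrite in_itv /= => /andP[sa sb].
by apply: ue; rewrite sb ltW.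
Qed.

End PathIntegral.

Section GridConvergence.
Context {R : realType}.
Local Notation mu := (@lebesgue_measure R).
Implicit Types (t : R) (y : nat -> nat -> R) (f g u x : R -> R).

Definition grid_cvg t (nu : nat -> nat) y f : Prop :=
  forall (N : nat) (e : R), 0 < e ->
  \forall j \near \oo, forall k, (k <= N * nu j)%N ->
    `|y j k - f (grid_time t (nu j) k)| < e.

Lemma grid_time_le t n k (N : nat) : 0 <= t -> (k <= N * n)%N ->
  0 <= grid_time t n k <= t * N%:R.
Proof.
move=> t0 kN; rewrite grid_time_ge0//=; case: n kN => [|n] kN.
  by rewrite /grid_time invr0 mulr0 mulr_ge0.
by rewrite /grid_time ler_pdivrMr ?ltr0n// -mulrA -natrM ler_wpM2l// ler_nat.
Qed.

Lemma nat_near_ge (r : R) : \forall n \near \oo, r <= n%:R.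
Proof.
exists (Num.trunc `|r|).+1 => // n /= rn.
rewrite (le_trans (ler_norm r))// ltW// (lt_le_trans (truncnS_gt _))//.
by rewrite ler_nat.
Qed.

Lemma near_ge (nu : nat -> nat) (r : R) : nu j @[j --> \oo] --> \oo ->
  \forall j \near \oo, r <= (nu j)%:R.
Proof. by move=> /(_ _ (nat_near_ge r)). Qed.

(** The defect of [u] in the Euler recursion is the rounding error plus [lambda]
    times the integral of the oscillation of [u] over one mesh; the latter is small
    relative to the mesh by uniform continuity, so [euler_stable] applies.  The case
    [lambda = 0] and [u = x] says that the rounded increments sum up to the path. *)
Lemma grid_cvg_euler (nu : nat -> nat) (x u : R -> R) (lambda t c : R) :
  nu j @[j --> \oo] --> \oo -> 0 <= lambda -> 0 < t ->
  continuous_path x -> continuous_path u -> x 0 = 0 ->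
  (forall r, 0 <= r -> u r = c + x r - lambda * \int[mu]_(s in `[0, r]) u s) ->
  grid_cvg t nu (fun j => euler (1 - lambda * t / (nu j)%:R) c
                         (fun i => Num.sqrt t * grid_code t (nu j) x i)) u.
Proof.
move=> nuy l0 t0 cx cu x0 uE N e e0.
have st0 : 0 < Num.sqrt t by rewrite sqrtr_gt0.
have [B B0 xB] := continuous_path_bounded x (t * N%:R) cx.
set e' := e / (2 * (lambda * N%:R * t + 1)).
have c1 : 0 < 2 * (lambda * N%:R * t + 1).
  by rewrite mulr_gt0// ltr_wpDl// !mulr_ge0// ltW.
have e'0 : 0 < e' by rewrite divr_gt0.
have [r r0 ru] := continuous_path_unif u (t * N%:R) e' cu e'0.
near=> j; set n := nu j.
have n1 : 1 <= n%:R :> R by rewrite /n; near: j; exact: near_ge.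
have nlt : lambda * t <= n%:R by rewrite /n; near: j; exact: near_ge.
have nB : (Num.sqrt t)^-1 * (2 * B) <= n%:R by rewrite /n; near: j; exact: near_ge.
have nr : 2 * t / r <= n%:R by rewrite /n; near: j; exact: near_ge.
have nN : 4 * (N%:R * Num.sqrt t) / e <= n%:R by rewrite /n; near: j; exact: near_ge.
have n0 : 0 < n%:R :> R by rewrite (lt_le_trans ltr01).
have n0' : (0 < n)%N by rewrite -(ltr0n R).
have tr : t / n%:R < r.
  move: nr; rewrite ler_pdivrMr// => nr; rewrite ltr_pdivrMr//.
  by rewrite mulrC; nra.
have tn0 : 0 <= t / n%:R by rewrite divr_ge0// ltW.
pose dd : R := Num.sqrt t / n%:R ^+ 3 + lambda * (t / n%:R * e').
have dd0 : 0 <= dd.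
  apply: addr_ge0; first by rewrite divr_ge0 ?sqrtr_ge0 ?exprn_ge0.
  by rewrite mulr_ge0// mulr_ge0// ltW.
move=> k kN.
have a01 : 0 <= 1 - lambda * t / n%:R <= 1.
  rewrite subr_ge0 ler_pdivrMr// mul1r nlt /= lerBlDr lerDl.
  by rewrite divr_ge0// mulr_ge0// ltW.
have Sk : forall k, (k < N * n)%N ->
  `|u (grid_time t n k.+1) - ((1 - lambda * t / n%:R) * u (grid_time t n k) +
     Num.sqrt t * grid_code t n x k)| <= dd.
  move=> {kN}k kN.
  set a := grid_time t n k; set b := grid_time t n k.+1.
  have ab : b - a = t / n%:R by rewrite /b grid_timeS addrC addKr.
  have /andP[a0 aN] : 0 <= a <= t * N%:R.
    exact: grid_time_le (ltW t0) (ltnW kN).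
  have /andP[b0 bN] : 0 <= b <= t * N%:R.
    exact: grid_time_le (ltW t0) kN.
  have aleb : a <= b by rewrite -subr_ge0 ab.
  have inc : `|grid_increment t n x k| <= n%:R.
    rewrite normrM (gtr0_norm (x := _^-1)) ?invr_gt0//.
    apply: le_trans nB; rewrite ler_wpM2l ?invr_ge0 ?sqrtr_ge0//.
    rewrite (le_trans (ler_normB _ _))// mulr_natl mulr2n.
    by rewrite lerD// xB// ?a0 ?b0.
  have qd : `|grid_code t n x k - grid_increment t n x k| <= (n%:R ^+ 3)^-1.
    rewrite -natrX; apply: quantise_approx; first by rewrite expn_gt0 n0'.
    by rewrite !natrX (exprSr _ 3) ler_wpM2l// exprn_ge0.
  have H := path_integral_increment u a b (u a) e' cu a0 aleb _.
  have {}H : `|\int[mu]_(s in `[0, b]) u s - \int[mu]_(s in `[0, a]) u s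
      - t / n%:R * u a| <= t / n%:R * e'.
    rewrite -ab; apply: H => s /andP[as_ sb]; rewrite distrC ltW//.
    apply: ru; [by rewrite a0|exact: le_trans as_|].
    rewrite distrC ger0_norm ?subr_ge0//.
    by apply: le_lt_trans tr; rewrite -ab lerB.
  have xinc : x b - x a = Num.sqrt t * grid_increment t n x k.
    by rewrite /grid_increment mulrA mulfV ?gt_eqF// mul1r.
  have -> : u b - ((1 - lambda * t / n%:R) * u a + Num.sqrt t * grid_code t n x k) =
    - (Num.sqrt t * (grid_code t n x k - grid_increment t n x k)) -
    lambda * (\int[mu]_(s in `[0, b]) u s - \int[mu]_(s in `[0, a]) u s
      - t / n%:R * u a).
    rewrite [u b]uE// mulrBr -xinc.
    rewrite (_ : (1 - lambda * t / n%:R) * u a = u a - lambda * (t / n%:R * u a));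
      last by ring.
    by rewrite [X in - (X - _ + _)]uE//; ring.
  rewrite (le_trans (ler_normB _ _))// lerD//.
    by rewrite normrN normrM gtr0_norm// ler_wpM2l// ltW.
  by rewrite normrM ger0_norm// ler_wpM2l.
apply: le_lt_trans (euler_stable _ _ _ (fun k => u (grid_time t n k)) dd (N * n)
  a01 _ Sk k kN) _.
  rewrite /grid_time mulr0 mul0r uE// x0 addr0 set_itv1 Rintegral_set1.
  by rewrite mulr0 subr0.
apply: (@le_lt_trans _ _ ((N%:R * n%:R) * dd)).
  by rewrite ler_wpM2r// -natrM ler_nat.
have -> : N%:R * n%:R * dd =
   N%:R * Num.sqrt t / n%:R ^+ 2 + (lambda * N%:R * t) * e'.
  by rewrite /dd; field; rewrite gt_eqF.
have h1 : (lambda * N%:R * t) * e' < e / 2.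
  have D0 : 0 < lambda * N%:R * t + 1 by rewrite ltr_wpDl// !mulr_ge0// ltW.
  have -> : (lambda * N%:R * t) * e' =
      (e / 2) * ((lambda * N%:R * t) / (lambda * N%:R * t + 1)).
    by rewrite /e'; field; rewrite gt_eqF.
  rewrite gtr_pMr ?divr_gt0// ltr_pdivrMr// mul1r ltrDl//.
have h2 : N%:R * Num.sqrt t / n%:R ^+ 2 <= e / 2.
  rewrite ler_pdivrMr ?exprn_gt0//.
  move: nN; rewrite ler_pdivrMr// => nN.
  have : n%:R * e <= n%:R ^+ 2 * e by rewrite ler_wpM2r ?expr2 ?ler_peMr// ltW.
  have : 0 <= N%:R * Num.sqrt t by rewrite mulr_ge0// ltW.
  lra.
lra.
Unshelve. all: by end_near.
Qed.

(** Such a path is cadlag for any values [y], even if they come from logarithms of 0: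
    discrete approximations of [log |Z|] are legitimate paths although the chain
    may visit the origin. *)
Definition step n (y : nat -> R) (s : R) : R := y (Num.trunc (n%:R * s)).

Lemma step_cadlag n (y : nat -> R) : (0 < n)%N -> cadlag (step n y).
Proof.
move=> n0; have n0' : 0 < n%:R :> R by rewrite ltr0n.
split=> s s0.
  apply/cvgrPdist_lt => e e0.
  have ns0 : 0 <= n%:R * s by rewrite mulr_ge0.
  have /andP[k1 k2] := truncn_itv ns0.
  set k := Num.trunc (n%:R * s) in k1 k2.
  near=> s'; rewrite /step (_ : Num.trunc (n%:R * s') = k) ?subrr ?normr0//.
  have ss' : s < s' by near: s'; exact: nbhs_right_gt.
  have s'k : s' < k.+1%:R / n%:R.
    by near: s'; apply: nbhs_right_lt; rewrite ltr_pdivlMr// mulrC.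
  apply: truncn_def; rewrite (le_trans k1) ?ler_pM2l ?(ltW ss')//=.
  by move: s'k; rewrite ltr_pdivlMr// mulrC.
have ns0 : 0 < n%:R * s by rewrite mulr_gt0.
have [k /andP[k1 k2]] : exists k : nat, k%:R < n%:R * s <= k.+1%:R.
  have /andP[k1 k2] := truncn_itv (ltW ns0).
  move: k1; rewrite le_eqVlt => /predU1P[kE|k1]; last first.
    by exists (Num.trunc (n%:R * s)); rewrite k1 ltW.
  case K : (Num.trunc (n%:R * s)) kE => [|k] kE.
    by move: ns0; rewrite -kE ltxx.
  by exists k; rewrite -kE lexx andbT ltr_nat.
apply/cvg_ex; exists (y k); apply/cvgrPdist_lt => e e0.
near=> s'; rewrite /step (_ : Num.trunc (n%:R * s') = k) ?subrr ?normr0//.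
have ss' : s' < s by near: s'; exact: nbhs_left_lt.
have s'k : k%:R / n%:R < s'.
  by near: s'; apply: nbhs_left_gt; rewrite ltr_pdivrMr// mulrC.
apply: truncn_def; apply/andP; split.
  by move: s'k; rewrite ltr_pdivrMr// mulrC => /ltW.
by rewrite (lt_le_trans _ k2)// ltr_pM2l.
Unshelve. all: by end_near.
Qed.

Lemma step_unif_cvg t (nu : nat -> nat) y f : nu j @[j --> \oo] --> \oo ->
  0 <= t -> continuous_path f -> grid_cvg t nu y f ->
  forall N e : R, 0 < e -> \forall j \near \oo, forall s : R, 0 <= s <= N ->
    `|step (nu j) (y j) s - f (s * t)| < e.
Proof.
move=> nuy t0 cf yf N e e0.
set N' := (Num.trunc `|N|).+1.
have NN' : N <= N'%:R by rewrite (le_trans (ler_norm N))// ltW// truncnS_gt.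
have e2 : 0 < e / 2 by rewrite divr_gt0.
have [r r0 fr] := continuous_path_unif f (t * N'%:R) (e / 2) cf e2.
near=> j; set n := nu j.
have n1 : 1 <= n%:R :> R by rewrite /n; near: j; exact: near_ge.
have n0 : 0 < n%:R :> R by rewrite (lt_le_trans ltr01).
have nr : 2 * t / r <= n%:R by rewrite /n; near: j; exact: near_ge.
have yfj : forall k, (k <= N' * n)%N -> `|y j k - f (grid_time t n k)| < e / 2.
  by rewrite /n; near: j; exact: yf.
move=> s /andP[s0 sN].
have ns0 : 0 <= n%:R * s by rewrite mulr_ge0// ltW.
have /andP[k1 k2] := truncn_itv ns0.
rewrite /step; set k := Num.trunc (n%:R * s) in k1 k2 *.
have kN : (k <= N' * n)%N.
  rewrite -(ler_nat R) natrM (le_trans k1)// mulrC ler_wpM2r// ?(ltW n0)//.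
  exact: le_trans NN'.
rewrite (splitr e) -(subrKA (f (grid_time t n k))).
rewrite (le_lt_trans (ler_normD _ _))// ltrD ?yfj//.
apply: fr; first exact: grid_time_le.
  by rewrite mulr_ge0.
have -> : grid_time t n k - s * t = - (t / n%:R * (n%:R * s - k%:R)).
  by rewrite /grid_time; field; rewrite gt_eqF.
rewrite normrN ger0_norm; last first.
  by rewrite mulr_ge0 ?subr_ge0// divr_ge0// ltW.
have tn0 : 0 <= t / n%:R by rewrite divr_ge0// ltW.
apply: (@le_lt_trans _ _ (t / n%:R)).
  by rewrite ler_piMr// lerBlDl natr1 ltW.
move: nr; rewrite ler_pdivrMr// => nr; rewrite ltr_pdivrMr//.
by rewrite mulrC; nra.
Unshelve. all: by end_near.
Qed.

Lemma skorokhod_cvg_unif (x_ : nat -> R -> R) x :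
  (forall N e : R, 0 < e -> \forall n \near \oo, forall s : R, 0 <= s <= N ->
    `|x_ n s - x s| < e) -> skorokhod_cvg x_ x.
Proof.
move=> h; exists (fun=> id); split => //.
  move=> n; split => //.
    by apply: continuous_subspaceT => ?; exact: cvg_id.
by move=> e e0; near=> n => s _; rewrite subrr normr0.
Unshelve. all: by end_near.
Qed.

Lemma ln_sqrt (p : R) : ln (Num.sqrt p) = 2^-1 * ln p.
Proof.
have [p0|p0] := ltP 0 p; last by rewrite ler0_sqrtr// !ln0// mulr0.
have sp : 0 < Num.sqrt p by rewrite sqrtr_gt0.
have -> : ln p = ln (Num.sqrt p) + ln (Num.sqrt p).
  by rewrite -lnM ?posrE// -expr2 sqr_sqrtr// ltW.
by field.
Qed.

Lemma ln_lipschitz (m a b : R) : 0 < m -> m <= a -> m <= b ->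
  `|ln a - ln b| <= `|a - b| / m.
Proof.
move=> m0; wlog ba : a b / b <= a.
  move=> h ma mb; have [/h|/ltW/h] := leP b a; first exact.
  by rewrite distrC (distrC a); exact.
move=> ma mb; have b0 : 0 < b by rewrite (lt_le_trans m0).
have a0 : 0 < a by rewrite (lt_le_trans m0).
rewrite !ger0_norm ?subr_ge0 ?ler_ln ?posrE//.
rewrite -ln_div ?posrE// (le_trans (ln_le_sub1 _ _)) ?divr_gt0//.
rewrite -[X in _ - X](divff (lt0r_neq0 b0)) -mulrBl ler_wpM2l ?subr_ge0//.
by rewrite lef_pV2 ?posrE.
Qed.

(** The limit stays away from the origin on every bounded interval, where the
    logarithm of the squared modulus is Lipschitz. *)
Lemma grid_cvg_ln t (nu : nat -> nat) (c : R) y1 y2 u1 u2 : 0 <= t ->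
  continuous_path u1 -> continuous_path u2 ->
  (forall s, 0 <= s -> 0 < u1 s ^+ 2 + u2 s ^+ 2) ->
  grid_cvg t nu y1 u1 -> grid_cvg t nu y2 u2 ->
  grid_cvg t nu (fun j k => c * ln (Num.sqrt (y1 j k ^+ 2 + y2 j k ^+ 2)))
    (fun s => c * ln (Num.sqrt (u1 s ^+ 2 + u2 s ^+ 2))).
Proof.
move=> t0 cu1 cu2 upos yu1 yu2 N e e0.
have tN0 : 0 <= t * N%:R by rewrite mulr_ge0.
have [B1 B10 uB1] := continuous_path_bounded u1 (t * N%:R) cu1.
have [B2 B20 uB2] := continuous_path_bounded u2 (t * N%:R) cu2.
have [s1] := EVT_min tN0 (continuous_path_within _ (t * N%:R)
  (continuous_path_sqr_add u1 u2 cu1 cu2)).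
rewrite in_itv /= => /andP[s10 _].
set m := u1 s1 ^+ 2 + u2 s1 ^+ 2 => mP.
have m0 : 0 < m by exact: upos.
set K := 2 * B1 + 2 * B2 + 2.
have K0 : 0 < K by rewrite /K; lra.
set d := Num.min 1 (Num.min (m / (2 * K)) (e * m / (2 * K * (1 + `|c|)))).
have c0 : 0 < 1 + `|c| by rewrite ltr_wpDr.
have d0 : 0 < d by rewrite !lt_min ltr01 !divr_gt0 ?mulr_gt0.
near=> j => k kN.
have H1 : `|y1 j k - u1 (grid_time t (nu j) k)| < d.
  by move: k kN; near: j; exact: yu1.
have H2 : `|y2 j k - u2 (grid_time t (nu j) k)| < d.
  by clear H1; move: k kN; near: j; exact: yu2.
have rN := grid_time_le t (nu j) k N t0 kN.
set r := grid_time t (nu j) k in H1 H2 rN *.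
have b1 := uB1 r rN; have b2 := uB2 r rN.
have mp : m <= u1 r ^+ 2 + u2 r ^+ 2 by apply: mP; rewrite in_itv.
have [d1 d2 d3] : [/\ d <= 1, d <= m / (2 * K) & d <= e * m / (2 * K * (1 + `|c|))].
  by split; rewrite !ge_min ?lexx ?orbT.
have sq (y u B : R) : `|y - u| < d -> `|u| <= B ->
    `|y ^+ 2 - u ^+ 2| <= d * (2 * B + 1).
  move=> yu uB; rewrite subr_sqr normrM ler_pM// ?(ltW yu)//.
  have -> : y + u = (y - u) + (u + u) by ring.
  rewrite (le_trans (ler_normD _ _))//.
  have := ler_normD u u; have := ltW yu; lra.
have q1 := sq _ _ _ H1 b1; have q2 := sq _ _ _ H2 b2.
set p' := y1 j k ^+ 2 + y2 j k ^+ 2; set p := u1 r ^+ 2 + u2 r ^+ 2 in mp *.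
have pp' : `|p' - p| <= d * K.
  have -> : p' - p = (y1 j k ^+ 2 - u1 r ^+ 2) + (y2 j k ^+ 2 - u2 r ^+ 2).
    by rewrite /p' /p; ring.
  by rewrite (le_trans (ler_normD _ _))// /K; lra.
have dK : d * K <= m / 2.
  have -> : m / 2 = m / (2 * K) * K by field; rewrite gt_eqF.
  by rewrite ler_wpM2r// ltW.
have p'm : m / 2 <= p'.
  by move: (le_trans pp' dK); rewrite ler_norml => /andP[]; lra.
rewrite !ln_sqrt -mulrBr -mulrBr normrM.
have L : `|ln p' - ln p| <= d * K / (m / 2).
  apply: le_trans (ln_lipschitz (m / 2) p' p _ p'm _) _; [lra|lra|].
  by rewrite ler_wpM2r// invr_ge0; lra.
have dKe : d * K / (m / 2) <= e / (1 + `|c|).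
  have -> : e / (1 + `|c|) = e * m / (2 * K * (1 + `|c|)) * (K / (m / 2)).
    by field; rewrite !gt_eqF.
  by rewrite -mulrA ler_wpM2r// divr_ge0; lra.
rewrite normrM (@gtr0_norm _ 2^-1) ?invr_gt0//.
have L0 := normr_ge0 (ln p' - ln p).
have L' : `|ln p' - ln p| <= e / (1 + `|c|) by exact: le_trans dKe.
apply: (@le_lt_trans _ _ (`|c| * (2^-1 * (e / (1 + `|c|))))).
  by rewrite ler_wpM2l// ler_wpM2l.
have -> : `|c| * (2^-1 * (e / (1 + `|c|))) = e * (2^-1 * (`|c| / (1 + `|c|))).
  by field; rewrite gt_eqF.
rewrite gtr_pMr//; have : `|c| / (1 + `|c|) <= 1.
  by rewrite ler_pdivrMr// mul1r; lra.
lra.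
Unshelve. all: by end_near.
Qed.

End GridConvergence.

(** * The Euler scheme at small times *)

Section SmallTime.
Context {R : realType}.
Implicit Types (x y : R -> R).

Lemma grid_cvg_partial_sums (nu : nat -> nat) x :
  nu j @[j --> \oo] --> \oo -> continuous_path x -> x 0 = 0 ->
  grid_cvg 1 nu (fun j => euler 1 0 (grid_code 1 (nu j) x)) x.
Proof.
move=> nuy cx x0.
have := @grid_cvg_euler _ nu x x 0 1 0 nuy (lexx _) ltr01 cx cx x0.
rewrite (_ : (fun j => euler _ _ _) = fun j => euler 1 0 (grid_code 1 (nu j) x)).
  by apply=> r _; rewrite mul0r subr0 add0r.
apply/funext => j; rewrite !mul0r subr0; congr (euler _ _ _).
by apply/funext => i; rewrite sqrtr1 mul1r.
Qed.

(** [log |1 + s (a + i b) + O(s^2)| = s a + O(s^2)], with an explicit constant: the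
    imaginary part contributes only to second order. *)
Lemma ln_norm_expansion (s a b a' b' M C : R) : 0 < s -> s <= 1 ->
  0 <= M -> 0 <= C -> `|a| <= M -> `|b| <= M ->
  `|a' - (1 + s * a)| <= C * s ^+ 2 -> `|b' - s * b| <= C * s ^+ 2 ->
  let D := 2 * C + 2 * (M + C) ^+ 2 in
  s * (2 * M + D) <= 2^-1 ->
  `|s^-1 * ln (Num.sqrt (a' ^+ 2 + b' ^+ 2)) - a| <=
    s * (D + 2 * (2 * M + D) ^+ 2).
Proof.
move=> s0 s1 M0 C0 aM bM a'C b'C D sD.
have D0 : 0 <= D by rewrite addr_ge0// mulr_ge0// sqr_ge0.
set A := a' - (1 + s * a) in a'C; set A' := b' - s * b in b'C.
have ss : s ^+ 2 <= s by rewrite expr2 ler_piMl// ltW.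
have s20 : 0 <= s ^+ 2 by rewrite sqr_ge0.
have small (z Z : R) : `|z| <= M -> `|Z| <= C * s ^+ 2 ->
    (s * z + Z) ^+ 2 <= s ^+ 2 * (M + C) ^+ 2.
  move=> zM ZC; rewrite -exprMn -[leLHS]real_normK ?num_real//.
  rewrite ler_pXn2r ?nnegrE ?mulr_ge0 ?addr_ge0 ?(ltW s0)//.
  rewrite (le_trans (ler_normD _ _))// mulrDr lerD//.
    by rewrite normrM gtr0_norm// ler_wpM2l// ltW.
  by rewrite (le_trans ZC)// mulrC ler_wpM2r.
set rho := a' ^+ 2 + b' ^+ 2 - 1.
have rhoE : rho - 2 * (s * a) = 2 * A + ((s * a + A) ^+ 2 + (s * b + A') ^+ 2).
  by rewrite /rho /A /A'; ring.
have r1 : `|rho - 2 * (s * a)| <= D * s ^+ 2.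
  rewrite rhoE (le_trans (ler_normD _ _))// normrM (@ger0_norm _ 2)//.
  rewrite (@ger0_norm _ (_ ^+ 2 + _)) ?addr_ge0 ?sqr_ge0//.
  by have := small a A aM a'C; have := small b A' bM b'C; rewrite /D; lra.
have saM : `|s * a| <= s * M by rewrite normrM gtr0_norm// ler_wpM2l// ltW.
have r2 : `|rho| <= s * (2 * M + D).
  have -> : rho = (rho - 2 * (s * a)) + 2 * (s * a) by ring.
  rewrite (le_trans (ler_normD _ _))//.
  have -> : `|2 * (s * a)| = 2 * `|s * a| by rewrite normrM (@ger0_norm _ 2).
  have : D * s ^+ 2 <= D * s by rewrite ler_wpM2l.
  lra.
have r3 : rho ^+ 2 <= s ^+ 2 * (2 * M + D) ^+ 2.
  rewrite -exprMn -[leLHS]real_normK ?num_real//.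
  by rewrite ler_pXn2r ?nnegrE// (le_trans (normr_ge0 rho)).
have rho2 : - 2^-1 <= rho.
  by move: (le_trans r2 sD); rewrite ler_norml => /andP[].
have rho1 : 0 < 1 + rho by lra.
have lnU : ln (1 + rho) <= rho by have := ln_le_sub1 _ rho1; lra.
have lnL := ln1D_ge rho rho2.
rewrite (_ : a' ^+ 2 + b' ^+ 2 = 1 + rho); last by rewrite /rho; ring.
rewrite ln_sqrt.
have -> : s^-1 * (2^-1 * ln (1 + rho)) - a =
   s^-1 * (2^-1 * ((ln (1 + rho) - rho) + (rho - 2 * (s * a)))).
  by field; rewrite gt_eqF.
rewrite normrM gtr0_norm ?invr_gt0// mulrC ler_pdivrMr//.
rewrite normrM (@gtr0_norm _ 2^-1) ?invr_gt0//.
have h : `|ln (1 + rho) - rho| <= 2 * (s ^+ 2 * (2 * M + D) ^+ 2).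
  by rewrite ler_norml; apply/andP; split; lra.
have h2 := ler_normD (ln (1 + rho) - rho) (rho - 2 * (s * a)).
have h3 : 0 <= D * s ^+ 2 by rewrite mulr_ge0.
have h4 : 0 <= s ^+ 2 * (2 * M + D) ^+ 2 by rewrite mulr_ge0// sqr_ge0.
have -> : s * (D + 2 * (2 * M + D) ^+ 2) * s =
  D * s ^+ 2 + 2 * (s ^+ 2 * (2 * M + D) ^+ 2) by ring.
lra.
Qed.

(** Up to time [N] the drift displaces the chain by [O(tau)], so the chain is
    [1 + sqrt tau (x + i y) + O(tau)] and [ln_norm_expansion] applies with
    [s = sqrt tau]. *)
Lemma grid_cvg_small_time (nu : nat -> nat) (tau : nat -> R) (lambda : R) x y :
  nu j @[j --> \oo] --> \oo ->
  (forall j, 0 < tau j) -> tau j @[j --> \oo] --> (0 : R) -> 0 <= lambda ->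
  continuous_path x -> continuous_path y -> x 0 = 0 -> y 0 = 0 ->
  grid_cvg 1 nu (fun j k => (Num.sqrt (tau j))^-1 * ln (Num.sqrt
    ((euler (1 - lambda * tau j / (nu j)%:R) 1
        (fun i => Num.sqrt (tau j) * grid_code 1 (nu j) x i) k) ^+ 2 +
     (euler (1 - lambda * tau j / (nu j)%:R) 0
        (fun i => Num.sqrt (tau j) * grid_code 1 (nu j) y i) k) ^+ 2))) x.
Proof.
move=> nuy tau0 taucvg l0 cx cy x0 y0 N e e0.
have [B1 B10 xB1] := continuous_path_bounded x (1 * N%:R) cx.
have [B2 B20 yB2] := continuous_path_bounded y (1 * N%:R) cy.
pose M := B1 + B2 + 1.
have M0 : 0 <= M by rewrite /M; lra.
pose C := N%:R * (lambda * (1 + M)).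
have C0 : 0 <= C by rewrite !mulr_ge0//; lra.
pose D := 2 * C + 2 * (M + C) ^+ 2.
have D0 : 0 <= D by rewrite addr_ge0// mulr_ge0// sqr_ge0.
pose K := D + 2 * (2 * M + D) ^+ 2 + 2 * (2 * M + D) + 1.
have K0 : 0 < K.
  by rewrite /K; have := sqr_ge0 (2 * M + D); lra.
have e2 : 0 < e / 2 by rewrite divr_gt0.
pose s0 := Num.min 1 (Num.min (2^-1 / K) (e / 2 / K)).
have s00 : 0 < s0 by rewrite !lt_min ltr01 !divr_gt0 ?invr_gt0.
near=> j => k kN; set n := nu j.
have n1 : 1 <= n%:R :> R by rewrite /n; near: j; exact: near_ge.
have n0 : 0 < n%:R :> R by rewrite (lt_le_trans ltr01).
have tj : tau j < s0 ^+ 2.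
  near: j; have s20 : 0 < s0 ^+ 2 by rewrite exprn_gt0.
  by move: taucvg => /cvgrPdist_lt/(_ _ s20); apply: filterS => j;
    rewrite sub0r normrN gtr0_norm.
have nlt : lambda * s0 ^+ 2 <= n%:R by rewrite /n; near: j; exact: near_ge.
have S1 : forall k, (k <= N * nu j)%N ->
    `|euler 1 0 (grid_code 1 (nu j) x) k - x (grid_time 1 (nu j) k)| <
    Num.min 1 (e / 2).
  by near: j; apply: (grid_cvg_partial_sums nu x nuy cx x0); rewrite lt_min ltr01.
have S2 : forall k, (k <= N * nu j)%N ->
    `|euler 1 0 (grid_code 1 (nu j) y) k - y (grid_time 1 (nu j) k)| < 1.
  by near: j; exact: (grid_cvg_partial_sums nu y nuy cy y0).
set s := Num.sqrt (tau j).
have sp : 0 < s by rewrite sqrtr_gt0.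
have ss : s ^+ 2 = tau j by rewrite sqr_sqrtr// ltW.
have ss0 : s <= s0.
  by rewrite -(@ler_pXn2r _ 2)// ?nnegrE ?(ltW sp) ?(ltW s00)// ss ltW.
have [h1 h2 h3] : [/\ s0 <= 1, s0 <= 2^-1 / K & s0 <= e / 2 / K].
  by split; rewrite !ge_min ?lexx ?orbT.
have SM1 k' : (k' <= N * n)%N -> `|euler 1 0 (grid_code 1 n x) k'| <= M.
  move=> k'N; have := S1 k' k'N; rewrite lt_min => /andP[q _].
  have := xB1 _ (grid_time_le 1 n k' N ler01 k'N).
  have := ler_normD (euler 1 0 (grid_code 1 n x) k' - x (grid_time 1 n k'))
    (x (grid_time 1 n k')); rewrite subrK /M => ? ?.
  by move: (ltW q); lra.
have SM2 k' : (k' <= N * n)%N -> `|euler 1 0 (grid_code 1 n y) k'| <= M.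
  move=> k'N; have q := S2 k' k'N.
  have := yB2 _ (grid_time_le 1 n k' N ler01 k'N).
  have := ler_normD (euler 1 0 (grid_code 1 n y) k' - y (grid_time 1 n k'))
    (y (grid_time 1 n k')); rewrite subrK /M => ? ?.
  by move: (ltW q); lra.
have a01 : 0 <= 1 - lambda * tau j / n%:R <= 1.
  rewrite subr_ge0 ler_pdivrMr// mul1r (le_trans _ nlt)//=; last first.
    by rewrite ler_wpM2l// ltW.
  by rewrite lerBlDr lerDl divr_ge0// ?mulr_ge0// ltW.
have drift c z : `|c| <= 1 ->
    (forall k', (k' <= N * n)%N -> `|euler 1 0 (grid_code 1 n z) k'| <= M) ->
    `|euler (1 - lambda * tau j / n%:R) c (fun i => s * grid_code 1 n z i) k
      - (c + s * euler 1 0 (grid_code 1 n z) k)| <= C * s ^+ 2.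
  move=> c1 zM.
  apply: le_trans (euler1_drift _ _ _ c s 0 (N * n) M a01 (erefl _) zM k kN) _.
  rewrite opprB addrC subrK.
  have -> : C * s ^+ 2 = (N * n)%:R * (lambda * tau j / n%:R * (1 + M)).
    by rewrite /C ss natrM; field; rewrite gt_eqF.
  apply: ler_pM => //.
  - rewrite !mulr_ge0 ?invr_ge0 ?(ltW (tau0 j))//.
    by rewrite addr_ge0// mulr_ge0.
  - by rewrite ler_nat.
  - rewrite ler_wpM2l ?divr_ge0 ?mulr_ge0 ?(ltW (tau0 j))//.
    by rewrite lerD// gtr0_norm// ler_piMl// (le_trans ss0).
have d1 := drift 1 x _ SM1; have d2 := drift 0 y _ SM2.
rewrite normr1 in d1; rewrite normr0 add0r in d2.
have sK : s * K <= e / 2 by rewrite -ler_pdivlMr// (le_trans ss0).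
have sK' : s * K <= 2^-1 by rewrite -ler_pdivlMr// (le_trans ss0).
have lnE := ln_norm_expansion s _ _ _ _ M C sp (le_trans ss0 h1) M0 C0
  (SM1 k kN) (SM2 k kN) (d1 (lexx _)) (d2 ler01).
have sK2 : s * (2 * M + D) <= s * K.
  by rewrite ler_wpM2l ?(ltW sp)// /K; have := sqr_ge0 (2 * M + D); lra.
have sK3 : s * (D + 2 * (2 * M + D) ^+ 2) <= s * K.
  by rewrite ler_wpM2l ?(ltW sp)// /K; lra.
have {}lnE := lnE (le_trans sK2 sK').
rewrite (splitr e) -(subrKA (euler 1 0 (grid_code 1 n x) k)).
rewrite (le_lt_trans (ler_normD _ _))// ler_ltD//.
  exact: le_trans lnE (le_trans sK3 sK).
by have := S1 k kN; rewrite lt_min => /andP[].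
Unshelve. all: by end_near.
Qed.

End SmallTime.

(** * Null sets and bounded convergence *)

Section NullSets.
Context {R : realType} {d : measure_display} {T : measurableType d}.
Variable P : probability T R.
Import HBNNSimple.

(* For arbitrary [f] and [g] the integral is a supremum over simple functions; one
   below [f] is made to vanish on [N], which does not alter its integral. *)
Let ge0_integral_null_le (N : set T) (f g : T -> \bar R) :
  measurable N -> P N = 0%E -> (forall w, 0 <= f w)%E -> (forall w, 0 <= g w)%E ->
  (forall w, ~ N w -> f w = g w) -> (\int[P]_w f w <= \int[P]_w g w)%E.
Proof.
move=> mN N0 f0 g0 fg; rewrite !ge0_integralTE//.
apply: ge_ereal_sup => _ [h hf <-].
pose h' : {nnsfun T >-> R} := mul_nnsfun h (indic_nnsfun R (measurableC mN)).
have h'E w : h' w = h w * \1_(~` N) w by [].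
apply: ereal_sup_ubound; exists h' => [w|].
  rewrite h'E indicE; have [Nw|Nw] := pselect (N w).
    by rewrite memNset ?mulr0 //= => nNw; exact: nNw Nw.
  by rewrite mem_set// mulr1 -fg//; exact: hf.
rewrite -!integralT_nnsfun; apply: ae_eq_integral => //.
- by apply/measurable_EFinP.
- by apply/measurable_EFinP.
exists N; split => // w /=; apply: contra_notP => Nw _.
by rewrite /mindic indicE mem_set ?mulr1.
Qed.

Lemma integral_null_eq (N : set T) (f g : T -> \bar R) :
  measurable N -> P N = 0%E -> (forall w, ~ N w -> f w = g w) ->
  (\int[P]_w f w = \int[P]_w g w)%E.
Proof.
move=> mN N0 fg; rewrite integralE [RHS]integralE; congr (_ - _)%E.
  by apply/eqP; rewrite eq_le !(ge0_integral_null_le N)// => w Nw;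
    rewrite !funeposE fg.
by apply/eqP; rewrite eq_le !(ge0_integral_null_le N)// => w Nw;
  rewrite !funenegE fg.
Qed.

(** The limit [H] is measurable only off a null set: a functional of a process is
    controlled only on the regular paths. *)
Lemma bounded_ae_cvg_expectation (H_ : nat -> T -> R) (H : T -> R) (M : R) :
  (forall n, measurable_fun setT (H_ n)) -> (forall n w, `|H_ n w| <= M) ->
  {ae P, forall w, H_ n w @[n --> \oo] --> H w} ->
  'E_P[H]%E \is a fin_num /\ ('E_P[H_ n] @[n --> \oo] --> 'E_P[H])%E.
Proof.
move=> mH HM [N [mN N0 sub]].
have cvgN w : ~ N w -> H_ n w @[n --> \oo] --> H w.
  by move=> Nw; apply: contrapT => h; apply: Nw; exact: sub.
pose K_ n w := H_ n w * \1_(~` N) w.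
pose K w := H w * \1_(~` N) w.
have indN w : ~ N w -> \1_(~` N) w = 1 :> R by move=> Nw; rewrite indicE mem_set.
have ind0 w : N w -> \1_(~` N) w = 0 :> R.
  by move=> Nw; rewrite indicE memNset// => nNw; exact: nNw Nw.
have KH w : ~ N w -> K w = H w by move=> Nw; rewrite /K indN// mulr1.
have KH_ n w : ~ N w -> K_ n w = H_ n w by move=> Nw; rewrite /K_ indN// mulr1.
have KcvgK w : K_ n w @[n --> \oo] --> K w.
  have [Nw|Nw] := pselect (N w).
    rewrite /K ind0// mulr0 (_ : K_ ^~ w = fun=> 0); first exact: cvg_cst.
    by apply/funext => n; rewrite /K_ ind0// mulr0.
  rewrite KH// (_ : K_ ^~ w = H_ ^~ w); first exact: cvgN.
  by apply/funext => n; rewrite KH_.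
have mK_ n : measurable_fun setT (K_ n).
  by apply: measurable_funM => //; apply: measurable_indic; exact: measurableC.
have mK : measurable_fun setT K.
  by apply: (measurable_fun_cvg (h := K_)) => // w _; exact: KcvgK.
rewrite unlock.
rewrite (integral_null_eq N _ (EFin \o K))//; last by move=> w Nw; rewrite /= KH.
have -> : (fun n => \int[P]_w (H_ n w)%:E)%E = (fun n => \int[P]_w (EFin \o K_ n) w)%E.
  apply/funext => n; apply: (integral_null_eq N) => // w Nw.
  by rewrite /= KH_.
have [|||||iK _] := @dominated_convergence _ _ _ P setT measurableT
  (fun n => EFin \o K_ n) (EFin \o K) (cst M%:E) _ _ _ _ _.
- by move=> n; apply/measurable_EFinP.
- exact/measurable_EFinP.
- by apply: aeW => w _; apply: cvg_EFin; [exact: nearW|exact: KcvgK].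
- exact: finite_measure_integrable_cst.
- apply: aeW => w n _; rewrite /= lee_fin /K_ normrM.
  have M0 : 0 <= M := le_trans (normr_ge0 _) (HM n w).
  rewrite (le_trans _ (HM n w))// ler_piMr// indicE.
  by case: (_ \in _); rewrite ?normr1 ?normr0.
by split=> //; exact: integrable_fin_num.
Qed.

Lemma negligible_small (A : set T) :
  (forall e : R, 0 < e -> exists B, [/\ measurable B, A `<=` B & (P B <= e%:E)%E]) ->
  P.-negligible A.
Proof.
move=> h; have h' (n : nat) := h n.+1%:R^-1 ltac:(by rewrite invr_gt0).
have [B BP] := choice h'.
exists (\bigcap_n B n); split.
- by apply: bigcap_measurable => // n _; case: (BP n).
- apply/eqP; rewrite eq_le measure_ge0 andbT; apply/lee_addgt0Pr => e e0.
  rewrite add0e; have [_ _ PB] := BP (Num.trunc e^-1).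
  apply: le_trans (le_trans PB _).
    apply: le_measure; rewrite ?inE.
    - by apply: bigcap_measurable => // n _; case: (BP n).
    - by case: (BP (Num.trunc e^-1)).
    - exact: bigcap_inf.
  rewrite lee_fin -[leRHS]invrK lef_pV2 ?posrE ?invr_gt0//.
  by rewrite ltW// truncnS_gt.
by move=> w Aw n _; case: (BP n) => _ AB _; exact: AB.
Qed.

Lemma liminf_events_prob (A : nat -> set T) (c : \bar R) :
  (forall n, measurable (A n)) -> (\forall n \near \oo, P (A n) <= c)%E ->
  let B := \bigcup_m \bigcap_(n in [set n | (m <= n)%N]) A n in
  measurable B /\ (P B <= c)%E.
Proof.
move=> mA PA B.
pose F m := \bigcap_(n in [set n | (m <= n)%N]) A n.
have mF m : measurable (F m) by apply: bigcap_measurable => //; exists m => /=.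
have mB : measurable B by apply: bigcup_measurable => m _; exact: mF.
split=> //.
have ndF : nondecreasing_seq F.
  by move=> m n mn; apply/subsetPset => w Fw k /= nk; apply: Fw => /=;
    exact: leq_trans nk.
have cv := nondecreasing_cvg_mu (mu := P) mF mB ndF.
rewrite -(cvg_lim _ cv)//; apply: lime_le; first by apply/cvg_ex; exists (P B).
case: PA => m _ PA; near=> n.
have Pmn : (P (A (maxn m n)) <= c)%E by apply: PA; rewrite /= leq_maxl.
apply: le_trans Pmn; apply: le_measure; rewrite ?inE//.
by move=> w Fw; apply: Fw; rewrite /= leq_maxr.
Unshelve. all: by end_near.
Qed.

End NullSets.

(** * The process avoids the origin *)

Section OUPaths.
Context {R : realType}.
Local Notation mu := (@lebesgue_measure R).

(** What almost surely holds for the pair [(W, Z)], split into real coordinates, so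
    that the rest of the argument concerns one path at a time. *)
Definition ou_path (lambda : R) (W Z : R -> R[i]) : Prop :=
  let X s := complex.Re (W s) in let Y s := complex.Im (W s) in
  let U s := complex.Re (Z s) in let V s := complex.Im (Z s) in
  [/\ [/\ continuous_path X, continuous_path Y, X 0 = 0 & Y 0 = 0],
      continuous_path U, continuous_path V,
      forall r, 0 <= r -> U r = 1 + X r - lambda * \int[mu]_(s in `[0, r]) U s &
      forall r, 0 <= r -> V r = 0 + Y r - lambda * \int[mu]_(s in `[0, r]) V s].

Context {d : measure_display} {T : measurableType d}.
Variable P : probability T R.

Lemma ae_ou_path (lambda : R) (W Z : R -> T -> R[i]) :
  planar_brownian P W -> ornstein_uhlenbeck P W lambda (1 +i* 0) Z ->
  {ae P, forall w, ou_path lambda (W ^~ w) (Z ^~ w)}.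
Proof.
move=> [[_ X0 _ _ cX] [_ Y0 _ _ cY] _] [_ cZ eZ].
apply: filterS2 (filterI (filterI X0 cX) (filterI Y0 cY)) (filterI cZ eZ).
move=> w /= [[? ?] [? ?]] [[? ?] Zw]; split => //.
  move=> r r0; have := congr1 (@complex.Re R) (Zw r r0).
  rewrite /complex_integral; case: (W r w) => a b /= ->.
  by rewrite mul0r subr0.
move=> r r0; have := congr1 (@complex.Im R) (Zw r r0).
rewrite /complex_integral; case: (W r w) => a b /= ->.
by rewrite mul0r addr0.
Qed.

Lemma ou_radialE (Z : R -> R[i]) s :
  complex.Re `|Z s| = Num.sqrt (complex.Re (Z s) ^+ 2 + complex.Im (Z s) ^+ 2).
Proof. by case: (Z s) => a b. Qed.

End OUPaths.

Section AvoidOrigin.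
Context {R : realType} {d : measure_display} {T : measurableType d}.
Variable P : probability T R.
Implicit Types (lambda e : R) (W Z : R -> T -> R[i]).

(** The growth of the potential in one step is [O(1 / n)], with a constant that does
    not depend on [e] for fine meshes; over [N n] steps it adds up to a multiple of
    [N]. *)
Lemma hits_word_prob_le lambda e (L : R) n (N : nat) : 0 <= lambda ->
  (0 < n)%N -> 2 * lambda <= n%:R -> 80 * 128 / e ^+ 2 <= n%:R ->
  0 < e -> e <= 1 -> 0 < L -> L <= - ln (2 * e) ->
  word_mean (planar_values n) (@planar_step_prob R n) (N * n)
    (fun s => (hits e (1 - lambda / n%:R) 1 0 s)%:R) <=
  (2 + N%:R * (131 + 4 * lambda)) / L.
Proof.
move=> l0 n0 nl ne e0 e1 L0 eL.
have n0' : 0 < n%:R :> R by rewrite ltr0n.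
pose q := @resolve R n; pose s : R := Num.sqrt n%:R^-1.
have s0 : s != 0 by rewrite gt_eqF// sqrtr_gt0 invr_gt0.
have s2 : s ^+ 2 = n%:R^-1 by rewrite sqr_sqrtr// invr_ge0 ltW.
have s4 : s ^+ 4 = n%:R^-1 ^+ 2 by rewrite (exprM s 2 2) s2.
have qin y : q y \in resolve_values n by exact: quantise_in.
have mq : measurable_fun setT q by exact: measurable_resolve.
have uq := @resolve_values_uniq R n.
have n30 : (0 < n ^ 3)%N by rewrite expn_gt0 n0.
have qle y : `|q y| <= `|y| by exact: norm_quantise_le.
have qN y : q (- y) = - q y by exact: quantiseN.
pose v := \sum_(c <- resolve_values n) cell_prob q s c * c ^+ 2.
have v0 : v <= 65 * s ^+ 2 by exact: cell_prob_sqr.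
have m4 := cell_prob_quart q (resolve_values n) mq qin uq s s0 qle.
have a0 : 0 < 1 - lambda / n%:R.
  rewrite subr_gt0 ltr_pdivrMr// mul1r; clear -l0 nl n0'; lra.
have a1 : 1 - lambda / n%:R <= 1 by rewrite lerBlDr lerDl divr_ge0// ltW.
have H := hits_mean_le (resolve_values n) (cell_prob q s) uq
  (grid_valuesN (n ^ 3) (n ^ 4)) (cell_prob_ge0 q mq s)
  (fun c => cell_probN q mq s c s0 qN)
  (cell_prob_sum q (resolve_values n) mq qin uq s) v _ (erefl _) m4 e e0
  (1 - lambda / n%:R) L a0 a1 L0 eL 1 0 (N * n).
apply: le_trans H _; rewrite ler_wpM2r ?invr_ge0 ?(ltW L0)//.
have ln1 : 0 <= ln (1 ^+ 2 + 0 ^+ 2 + e) by rewrite ln_ge0//; clear -e0; lra.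
have lna : - (2 * ln (1 - lambda / n%:R)) <= 4 * (lambda / n%:R).
  have nl' : lambda / n%:R <= 2^-1 by rewrite ler_pdivrMr//; clear -nl; lra.
  have ln0 : 0 <= lambda / n%:R by rewrite divr_ge0// ltW.
  have := ln1D_ge (- (lambda / n%:R)); rewrite lerN2 => /(_ nl').
  by clear -nl' ln0; nra.
have term : 80 * (128 * s ^+ 4) / e ^+ 2 <= n%:R^-1.
  have e20 : 0 < e ^+ 2 by rewrite exprn_gt0.
  rewrite s4 (_ : 80 * (128 * n%:R^-1 ^+ 2) / e ^+ 2 =
    (80 * 128 / e ^+ 2 / n%:R) * n%:R^-1); last by field; rewrite !gt_eqF.
  by rewrite ler_piMl ?invr_ge0 ?(ltW n0')// ler_pdivrMr// mul1r.
have delta : 2 * v + 80 * (128 * s ^+ 4) / e ^+ 2 - 2 * ln (1 - lambda / n%:R) <=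
   (131 + 4 * lambda) / n%:R.
  rewrite (_ : (131 + 4 * lambda) / n%:R = 131 * n%:R^-1 + 4 * (lambda / n%:R));
    last by ring.
  rewrite s2 in v0.
  by clear -v0 term lna; lra.
have : (N * n)%:R * (2 * v + 80 * (128 * s ^+ 4) / e ^+ 2 -
     2 * ln (1 - lambda / n%:R)) <= N%:R * (131 + 4 * lambda).
  have -> : N%:R * (131 + 4 * lambda) = (N * n)%:R * ((131 + 4 * lambda) / n%:R).
    by rewrite natrM; field; rewrite gt_eqF.
  by rewrite ler_wpM2l.
have -> : 1 ^+ 2 + 0 ^+ 2 + e = 1 + e by ring.
rewrite (_ : 1 ^+ 2 + 0 ^+ 2 + e = 1 + e) in ln1; last by ring.
by clear -ln1 e1; lra.
Qed.

Let hit_event lambda e W n (N : nat) : set T := [set w |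
  hits e (1 - lambda / n%:R) 1 0 (mkseq (planar_code 1 n (W ^~ w)) (N * n))].

Let hit_eventE lambda e W n N : planar_brownian P W -> (0 < n)%N ->
  measurable (hit_event lambda e W n N) /\
  P (hit_event lambda e W n N) =
    (word_mean (planar_values n) (@planar_step_prob R n) (N * n)
    (fun s => (hits e (1 - lambda / n%:R) 1 0 s)%:R))%:E.
Proof.
move=> bW n0.
have [mh Eh] := expectation_planar_word P W 1 n (N * n)
  (fun s => (hits e (1 - lambda / n%:R) 1 0 s)%:R) bW ltr01 n0.
have mE : measurable (hit_event lambda e W n N).
  rewrite (_ : hit_event _ _ _ _ _ = setT `&` (fun w => (hits e (1 - lambda / n%:R)
    1 0 (mkseq (planar_code 1 n (W ^~ w)) (N * n)))%:R) @^-1` [set 1 : R]).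
    exact: mh.
  rewrite setTI; apply/seteqP; split => w; rewrite /hit_event /=; first by move=> ->.
  by case: (hits _ _ _ _ _) => //= /eqP; rewrite eq_sym oner_eq0.
split=> //; rewrite -Eh -expectation_indic//; congr expectation.
apply/funext => w; rewrite indicE; congr (_%:R); congr nat_of_bool.
by apply/idP/idP => [/set_mem//|h]; exact: mem_set.
Qed.

(** A path that visits 0 before time [N] makes the Euler chain enter the disc of
    radius [sqrt e] for all fine meshes, by pathwise convergence.  The lower limit of
    these events has probability at most a constant over [log (1 / (2 e))], for
    every [e]. *)
Lemma ou_avoids_origin lambda W Z : 0 <= lambda -> planar_brownian P W ->
  {ae P, forall w, ou_path lambda (W ^~ w) (Z ^~ w) -> forall s, 0 <= s ->
     0 < complex.Re (Z s w) ^+ 2 + complex.Im (Z s w) ^+ 2}.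
Proof.
move=> l0 bW.
suff H : forall N : nat, {ae P, forall w, ou_path lambda (W ^~ w) (Z ^~ w) ->
    forall s, 0 <= s <= N%:R ->
     0 < complex.Re (Z s w) ^+ 2 + complex.Im (Z s w) ^+ 2}.
  have /ae_foralln := H; apply: filterS => w Hw ow s s0.
  apply: (Hw (Num.trunc s).+1 ow); rewrite s0 /= ltW//.
  exact: truncnS_gt.
move=> N; apply: negligible_small => dl dl0.
pose C : R := 2 + N%:R * (131 + 4 * lambda).
have C0 : 0 < C by rewrite /C ltr_wpDr// mulr_ge0//; lra.
pose L : R := Num.max 1 (C / dl).
have L0 : 0 < L by rewrite lt_max ltr01.
pose e : R := expR (- L) / 2.
have e0 : 0 < e by rewrite divr_gt0// expR_gt0.
have e1 : e <= 1.
  have : expR (- L) <= 1 by rewrite expR_le1 oppr_le0 ltW.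
  by rewrite /e; lra.
have eL : L <= - ln (2 * e).
  by rewrite /e mulrC divfK// expRK opprK.
have CL : C / L <= dl.
  rewrite ler_pdivrMr// mulrC -ler_pdivrMr//.
  by rewrite /L le_max lexx orbT.
have n1 : \forall n \near \oo, (0 < n)%N by exists 1%N.
pose A n := if (0 < n)%N then hit_event lambda e W n N else set0.
have mA n : measurable (A n).
  by rewrite /A; case: ifP => // n0; case: (hit_eventE lambda e W n N bW n0).
have PA : (\forall n \near \oo, P (A n) <= dl%:E)%E.
  near=> n; have n0 : (0 < n)%N by near: n.
  rewrite /A n0; have [_ ->] := hit_eventE lambda e W n N bW n0.
  rewrite lee_fin; apply: le_trans CL.
  apply: hits_word_prob_le => //; first by near: n; exact: nat_near_ge.
  by near: n; exact: nat_near_ge.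
have [mB PB] := liminf_events_prob P A dl%:E mA PA.
eexists; split; [exact: mB| |exact: PB].
move=> w /= /not_implyP[[[cX cY X0 Y0] cU cV eU eV]] /existsNP[s].
move=> /not_implyP[sN /negP]; rewrite -leNgt => Zs.
have /andP[s0 _] := sN.
have d0 : 0 < Num.min 1 (e / 2) by rewrite lt_min ltr01 divr_gt0.
have idy : id j @[j --> \oo] --> \oo by exact: cvg_id.
have gU := grid_cvg_euler id _ _ lambda 1 1 idy l0 ltr01 cX cU X0 eU.
have gV := grid_cvg_euler id _ _ lambda 1 0 idy l0 ltr01 cY cV Y0 eV.
have sU := step_unif_cvg 1 id _ _ idy ler01 cU gU N%:R _ d0.
have sV := step_unif_cvg 1 id _ _ idy ler01 cV gV N%:R _ d0.
have [m _ mP] := filterI n1 (filterI sU sV).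
exists m => // n /= mn; have [n0 [Un Vn]] := mP n mn.
rewrite /A n0 /hit_event /=; apply/hitsP.
exists (Num.trunc (n%:R * s)).
  rewrite size_mkseq -(ler_nat R) natrM.
  have ns0 : 0 <= n%:R * s by rewrite mulr_ge0.
  have /andP[k1 _] := truncn_itv ns0; rewrite (le_trans k1)// mulrC.
  by rewrite ler_wpM2r//; case/andP: sN.
set k := Num.trunc _.
have kN : (k <= N * n)%N.
  have ns0 : 0 <= n%:R * s by rewrite mulr_ge0.
  have /andP[k1 _] := truncn_itv ns0.
  rewrite -(ler_nat R) natrM (le_trans k1)// mulrC.
  by rewrite ler_wpM2r//; case/andP: sN.
have {}Un := Un s sN; have {}Vn := Vn s sN.
rewrite /step -/k !mulr1 in Un Vn.
have zz : complex.Re (Z s w) ^+ 2 + complex.Im (Z s w) ^+ 2 == 0.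
  by rewrite eq_le Zs addr_ge0 ?sqr_ge0.
move: zz; rewrite paddr_eq0 ?sqr_ge0// !sqrf_eq0 => /andP[/eqP Us /eqP Vs].
rewrite Us subr0 in Un; rewrite Vs subr0 in Vn.
have sq (z : R) : `|z| < Num.min 1 (e / 2) -> z ^+ 2 <= e / 2.
  rewrite lt_min -[z ^+ 2]real_normK ?num_real// => /andP[z1 z2].
  by rewrite (le_trans _ (ltW z2))// expr2 ler_piMl// ltW.
rewrite (splitr e) lerD//.
  rewrite (eq_euler _ _ _ (fun i => Num.sqrt 1 * grid_code 1 n
    (fun r => complex.Re (W r w)) i) (N * n)) ?sq//.
  by move=> i iN; rewrite nth_mkseq// sqrtr1 mul1r.
rewrite (eq_euler _ _ _ (fun i => Num.sqrt 1 * grid_code 1 n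
  (fun r => complex.Im (W r w)) i) (N * n)) ?sq//.
by move=> i iN; rewrite nth_mkseq// sqrtr1 mul1r.
Unshelve. all: by end_near.
Qed.

End AvoidOrigin.

(** * Functionals of the paths *)

Section Convergence.
Context {R : realType}.

(** Past the end of [l] the chain continues without noise. *)
Definition log_path (lambda t : R) n (l : seq (R * R)) : R -> R :=
  step n (fun k => (Num.sqrt t)^-1 * ln (Num.sqrt
    ((euler (1 - lambda * t / n%:R) 1
        (fun i => Num.sqrt t * (nth (0, 0) l i).1) k) ^+ 2 +
     (euler (1 - lambda * t / n%:R) 0
        (fun i => Num.sqrt t * (nth (0, 0) l i).2) k) ^+ 2))).

Definition sum_path n (l : seq R) : R -> R := step n (euler 1 0 (nth 0 l)).

Lemma eq_grid_cvg (t : R) (nu : nat -> nat) y y' f :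
  (forall N : nat, \forall j \near \oo, forall k, (k <= N * nu j)%N ->
    y j k = y' j k) ->
  grid_cvg t nu y f -> grid_cvg t nu y' f.
Proof.
move=> yy' yf N e e0; near=> j => k kN.
have <- : y j k = y' j k by move: k kN; near: j; exact: yy'.
by move: k kN; near: j; exact: yf.
Unshelve. all: by end_near.
Qed.

(* Words of length [n^2] drive the scheme up to time [n], hence up to any fixed time
   once [n] is large. *)
Let near_square (nu : nat -> nat) (N : nat) : nu j @[j --> \oo] --> \oo ->
  \forall j \near \oo, (N * nu j <= nu j * nu j)%N.
Proof.
move=> nuy; have : \forall j \near \oo, N%:R <= (nu j)%:R :> R by exact: near_ge.
by apply: filterS => j; rewrite ler_nat => Nj; rewrite leq_mul2r Nj orbT.
Qed.

Variable F : (R -> R) -> R.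
Hypothesis F_bounded : bounded_functional F.
Hypothesis F_cont : skorokhod_continuous F.

Context {d : measure_display} {T : measurableType d}.
Variable P : probability T R.

Let nuS : j.+1 @[j --> \oo] --> \oo.
Proof.
by under eq_fun do rewrite -addn1; exact: cvg_addnr.
Qed.

Let F_cvg (nu : nat -> nat) y f t : (forall j, (0 < nu j)%N) ->
  nu j @[j --> \oo] --> \oo -> 0 <= t -> continuous_path f ->
  grid_cvg t nu y f ->
  F (step (nu j) (y j)) @[j --> \oo] --> F (fun s => f (s * t)).
Proof.
move=> nu0 nuy t0 cf yf; apply: F_cont.
- by move=> j; exact: step_cadlag.
- exact/continuous_path_cadlag/continuous_path_scale.
- by apply: skorokhod_cvg_unif; exact: step_unif_cvg.
Qed.

(** The finite sums depend neither on the probability space nor on [B]: two Brownian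
    motions have the same law. *)
Lemma brownian_functional_cvg (B : R -> T -> R) : brownian P B ->
  'E_P[fun w => F (B ^~ w)]%E \is a fin_num /\
  ((word_mean (resolve_values n.+1) (@step_prob R n.+1) (n.+1 * n.+1)
     (fun l => F (sum_path n.+1 l)))%:E @[n --> \oo] -->
   'E_P[fun w => F (B ^~ w)])%E.
Proof.
move=> bB; have [M FM] := F_bounded; have [_ B0 _ _ cB] := bB.
pose H_ n w := F (sum_path n.+1 (mkseq (grid_code 1 n.+1 (B ^~ w)) (n.+1 * n.+1))).
have HE n := expectation_grid_word P B 1 n.+1 (n.+1 * n.+1)
  (fun l => F (sum_path n.+1 l)) bB ltr01 (ltn0Sn n).
have -> : (fun n => (word_mean (resolve_values n.+1) (@step_prob R n.+1)
    (n.+1 * n.+1) (fun l => F (sum_path n.+1 l)))%:E) = fun n => 'E_P[H_ n]%E.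
  by apply/funext => n; case: (HE n).
apply: (bounded_ae_cvg_expectation P H_ _ M).
- by move=> n; case: (HE n).
- by move=> n w; exact: FM.
apply: filterS2 B0 cB => w B0 cB.
rewrite (_ : B ^~ w = fun s => B (s * 1) w); last first.
  by apply/funext => s; rewrite mulr1.
apply: (F_cvg _ _ (B ^~ w)) => //.
apply: (eq_grid_cvg _ _ (fun j => euler 1 0 (grid_code 1 j.+1 (B ^~ w)))).
  move=> N; near=> j => k kN; have Nj : (N * j.+1 <= j.+1 * j.+1)%N.
    by near: j; exact: (near_square S).
  apply: (eq_euler _ _ _ _ (j.+1 * j.+1)); last exact: leq_trans Nj.
  by move=> i ij; rewrite nth_mkseq.
exact: grid_cvg_partial_sums.
Unshelve. all: by end_near.
Qed.

(** At a fixed scale [t], as the mesh tends to 0. *)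
Lemma ou_functional_cvg (W Z : R -> T -> R[i]) (lambda t : R) :
  0 <= lambda -> planar_brownian P W ->
  ornstein_uhlenbeck P W lambda (1 +i* 0) Z -> 0 < t ->
  'E_P[fun w => F (fun s => (Num.sqrt t)^-1 * ln (radial Z (s * t) w))%R]%E
     \is a fin_num /\
  ((word_mean (planar_values n.+1) (@planar_step_prob R n.+1) (n.+1 * n.+1)
     (fun l => F (log_path lambda t n.+1 l)))%:E @[n --> \oo] -->
   'E_P[fun w => F (fun s => (Num.sqrt t)^-1 * ln (radial Z (s * t) w))%R])%E.
Proof.
move=> l0 bW oZ t0; have [M FM] := F_bounded.
pose H_ n w := F (log_path lambda t n.+1
  (mkseq (planar_code t n.+1 (W ^~ w)) (n.+1 * n.+1))).
have HE n := expectation_planar_word P W t n.+1 (n.+1 * n.+1)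
  (fun l => F (log_path lambda t n.+1 l)) bW t0 (ltn0Sn n).
have -> : (fun n => (word_mean (planar_values n.+1) (@planar_step_prob R n.+1)
    (n.+1 * n.+1) (fun l => F (log_path lambda t n.+1 l)))%:E) =
    fun n => 'E_P[H_ n]%E.
  by apply/funext => n; case: (HE n).
apply: (bounded_ae_cvg_expectation P H_ _ M).
- by move=> n; case: (HE n).
- by move=> n w; exact: FM.
apply: filterS2 (ae_ou_path P lambda W Z bW oZ) (ou_avoids_origin P lambda W Z l0 bW).
move=> w ow /(_ ow) pos; have [[cX cY X0 Y0] cU cV eU eV] := ow.
pose f s := (Num.sqrt t)^-1 * ln (Num.sqrt
  (complex.Re (Z s w) ^+ 2 + complex.Im (Z s w) ^+ 2)).
rewrite (_ : (fun s => _) = fun s => f (s * t)); last first.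
  by apply/funext => s; rewrite /radial (ou_radialE (Z ^~ w)).
have cf : continuous_path f.
  rewrite /f; under eq_fun do rewrite ln_sqrt.
  have c1 := continuous_path_ln _ (continuous_path_sqr_add _ _ cU cV) pos.
  move=> s; apply: cvgM; first exact: cvg_cst.
  by apply: cvgM; [exact: cvg_cst|exact: c1].
apply: (F_cvg S _ f) => //; first exact: ltW.
have gU := grid_cvg_euler S _ _ lambda t 1 nuS l0 t0 cX cU X0 eU.
have gV := grid_cvg_euler S _ _ lambda t 0 nuS l0 t0 cY cV Y0 eV.
apply: eq_grid_cvg (grid_cvg_ln _ _ _ _ _ _ _ (ltW t0) cU cV pos gU gV).
move=> N; near=> j => k kN; have Nj : (N * j.+1 <= j.+1 * j.+1)%N.
  by near: j; exact: (near_square S).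
have kj := leq_trans kN Nj.
congr (_ * ln (Num.sqrt (_ ^+ 2 + _ ^+ 2)));
  apply: (eq_euler _ _ _ _ (j.+1 * j.+1)) => // i ij; by rewrite nth_mkseq.
Unshelve. all: by end_near.
Qed.

(** The sums of [ou_functional_cvg], read as expectations for the scheme driven by the
    increments of [W] on the grid of mesh [1 / nu j], not [tau j / nu j]. *)
Lemma small_time_functional_cvg (W : R -> T -> R[i]) (lambda : R)
    (tau : nat -> R) (nu : nat -> nat) :
  0 <= lambda -> planar_brownian P W ->
  (forall j, 0 < tau j) -> tau j @[j --> \oo] --> (0 : R) ->
  (forall j, (0 < nu j)%N) -> nu j @[j --> \oo] --> \oo ->
  ((word_mean (planar_values (nu j)) (@planar_step_prob R (nu j)) (nu j * nu j)
     (fun l => F (log_path lambda (tau j) (nu j) l)))%:E @[j --> \oo] -->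
   'E_P[fun w => F (fun s => complex.Re (W s w))])%E.
Proof.
move=> l0 bW tau0 tauc nu0 nuy; have [M FM] := F_bounded.
pose H_ j w := F (log_path lambda (tau j) (nu j)
  (mkseq (planar_code 1 (nu j) (W ^~ w)) (nu j * nu j))).
have HE j := expectation_planar_word P W 1 (nu j) (nu j * nu j)
  (fun l => F (log_path lambda (tau j) (nu j) l)) bW ltr01 (nu0 j).
have -> : (fun j => (word_mean (planar_values (nu j)) (@planar_step_prob R (nu j))
    (nu j * nu j) (fun l => F (log_path lambda (tau j) (nu j) l)))%:E) =
    fun j => 'E_P[H_ j]%E.
  by apply/funext => j; case: (HE j).
have [_ //] : 'E_P[fun w => F (fun s => complex.Re (W s w))]%E \is a fin_num /\
   ('E_P[H_ j]%E @[j --> \oo] -->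
   'E_P[fun w => F (fun s => complex.Re (W s w))])%E.
apply: (bounded_ae_cvg_expectation P H_ _ M).
- by move=> j; case: (HE j).
- by move=> j w; exact: FM.
have [[_ X0 _ _ cX] [_ Y0 _ _ cY] _] := bW.
apply: filterS2 (filterI X0 cX) (filterI Y0 cY) => w [{}X0 {}cX] [{}Y0 {}cY].
rewrite (_ : (fun s => complex.Re (W s w)) =
  fun s => (fun s => complex.Re (W s w)) (s * 1)); last first.
  by apply/funext => s; rewrite mulr1.
apply: (F_cvg nu _ (fun s => complex.Re (W s w))) => //.
apply: eq_grid_cvg (grid_cvg_small_time nu tau lambda _ _ nuy tau0 tauc l0
  cX cY X0 Y0).
move=> N; near=> j => k kN; have Nj : (N * nu j <= nu j * nu j)%N.
  by near: j; exact: near_square.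
have kj := leq_trans kN Nj.
congr (_ * ln (Num.sqrt (_ ^+ 2 + _ ^+ 2)));
  apply: (eq_euler _ _ _ _ (nu j * nu j)) => // i ij; by rewrite nth_mkseq.
Unshelve. all: by end_near.
Qed.

End Convergence.

(** * Convergence in law *)

Theorem theorem3p2 (R : realType)
    (d : measure_display) (T : measurableType d) (P : probability T R)
    (d' : measure_display) (T' : measurableType d') (P' : probability T' R)
    (lambda : R) (hlambda : 0 <= lambda)
    (W : R -> T -> R[i]) (hW : planar_brownian P W)
    (Z : R -> T -> R[i])
    (hZ : ornstein_uhlenbeck P W lambda (1 +i* 0) Z)
    (beta : R -> T' -> R) (hbeta : brownian P' beta) :
  skorokhod_cvg_in_law P P'
    (fun (t s : R) (w : T) => (Num.sqrt t)^-1 * ln (radial Z (s * t) w)) 0^'+ beta.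
Proof.
split.
- near=> t; have t0 : 0 < t by near: t; exact: nbhs_right_gt.
  have [mZ _ _] := hZ; split=> [s s0|].
    have [mU mV] := mZ (s * t) (mulr_ge0 s0 (ltW t0)).
    apply: measurable_funM => //; apply: (measurableT_comp (@measurable_ln R)).
    rewrite (_ : radial Z (s * t) = fun w => Num.sqrt
        (complex.Re (Z (s * t) w) ^+ 2 + complex.Im (Z (s * t) w) ^+ 2)); last first.
      by apply/funext => w; rewrite /radial (ou_radialE (Z ^~ w)).
    apply: (measurableT_comp (continuous_measurable_fun (@sqrt_continuous R))).
    by apply: measurable_funD; exact: measurable_funX.
  apply: filterS2 (ae_ou_path P lambda W Z hW hZ)
    (ou_avoids_origin P lambda W Z hlambda hW).
  move=> w ow /(_ ow) pos; have [_ cU cV _ _] := ow.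
  have c1 := continuous_path_ln _ (continuous_path_sqr_add _ _ cU cV) pos.
  apply: continuous_path_cadlag.
  pose f r := (Num.sqrt t)^-1 * (2^-1 *
    ln (complex.Re (Z r w) ^+ 2 + complex.Im (Z r w) ^+ 2)).
  rewrite (_ : (fun s => _) = fun s => f (s * t)); last first.
    by apply/funext => s; rewrite /radial (ou_radialE (Z ^~ w)) ln_sqrt.
  apply: (continuous_path_scale f); first exact: ltW.
  move=> s; apply: cvgM; first exact: cvg_cst.
  by apply: cvgM; [exact: cvg_cst|exact: c1].
- have [mb _ _ _ cb] := hbeta; split => //.
  by apply: filterS cb => w; exact: continuous_path_cadlag.
move=> F Fb Fc.
pose EX t := 'E_P[fun w => F (fun s => (Num.sqrt t)^-1 * ln (radial Z (s * t) w))%R]%E.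
have EXn t : 0 < t -> EX t \is a fin_num.
  by move=> t0; have [] := ou_functional_cvg F Fb Fc P W Z lambda t hlambda hW hZ t0.
have [fb cvgb] := brownian_functional_cvg F Fb Fc P' beta hbeta.
have [bX _ _] := hW.
have [_ cvgX] := brownian_functional_cvg F Fb Fc P _ bX.
have EE : ('E_P[fun w => F (fun s => complex.Re (W s w))] =
           'E_P'[fun w => F (beta ^~ w)])%E.
  exact: cvg_unique cvgX cvgb.
rewrite -(fineK fb); apply: cvg_EFin.
  by near=> t; apply: EXn; near: t; exact: nbhs_right_gt.
apply/cvg_at_rightP => u [u0 uc].
pose wm j n := word_mean (planar_values n.+1) (@planar_step_prob R n.+1)
  (n.+1 * n.+1) (fun l => F (log_path lambda (u j) n.+1 l)).
(* The diagonal choice: at each scale [u j] a mesh for which the finite sum is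
   close to the expectation. *)
have approx j : exists n, (j <= n)%N /\ `|fine (EX (u j)) - wm j n| < j.+1%:R^-1.
  have [_] := ou_functional_cvg F Fb Fc P W Z lambda (u j) hlambda hW hZ (u0 j).
  rewrite -/(EX (u j)) -(fineK (EXn _ (u0 j))) => /fine_cvg /cvgrPdist_lt.
  move=> /(_ j.+1%:R^-1); rewrite invr_gt0 ltr0n => /(_ isT) [m _ mP].
  exists (maxn j m); split; first exact: leq_maxl.
  by apply: mP; rewrite /= leq_maxr.
have [nu nuP] := choice approx.
have nuy : (nu j).+1 @[j --> \oo] --> \oo.
  move=> A [m _ mA]; exists m => // j /= mj; apply: mA => /=.
  by rewrite (leq_trans mj)// (leq_trans (proj1 (nuP j))).
have := small_time_functional_cvg F Fb Fc P W lambda u (fun j => (nu j).+1)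
  hlambda hW u0 uc (fun j => ltn0Sn _) nuy.
rewrite EE -(fineK fb) => /fine_cvg wmc.
apply/cvgrPdist_lt => e e0; have e2 : 0 < e / 2 by rewrite divr_gt0.
move: wmc => /cvgrPdist_lt/(_ _ e2) wmc.
near=> j; rewrite (splitr e) -(subrKA (wm j (nu j))).
rewrite (le_lt_trans (ler_normD _ _))// ltrD//; first by near: j.
rewrite distrC (lt_le_trans (proj2 (nuP j)))// -[leRHS]invrK lef_pV2 ?posrE ?invr_gt0//.
have h : (e / 2)^-1 <= j%:R by near: j; exact: nat_near_ge.
by rewrite (le_trans h)// ler_nat.
Unshelve. all: by end_near.
Qed.
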